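(* There is an absolute constant $C$ such that for every positive integer $w$, $$\operatorname{val}(\mathcal P_w) \le w^{6.5 \lg w + C}.$$
   Context: An on-line poset $P^{\prec}=(V,\le_P,\prec)$ is a finite poset $P=(V,\le_P)$ together with a linear order $\prec$ of $V$ (the presentation order). An on-line chain partitioning algorithm $\mathcal A$ is a deterministic algorithm that assigns the vertices $v_1\prec\dots\prec v_n$ to disjoint chains $C_1,\dots,C_t$ so that, for each $i$, the chain to which $v_i$ is assigned is determined solely by the induced subposet $P[\{v_1,\dots,v_i\}]$ (with the order of presentation); assignments are irrevocable. Let $\chi_{\mathcal A}(P^\prec)$ be the number of nonempty chains $\mathcal A$ uses on $P^\prec$, $\chi_{\mathcal A}(P)=\max_\prec \chi_{\mathcal A}(P^\prec)$ over all presentation orders, and for a class $\mathcal P$ of posets, $\operatorname{val}_{\mathcal A}(\mathcal P)=\max_{P\in\mathcal P}\chi_{\mathcal A}(P)$ and $\operatorname{val}(\mathcal P)=\min_{\mathcal A}\operatorname{val}_{\mathcal A}(\mathcal P)$ over all on-line chain partitioning algorithms. $\mathcal P_w$ denotes the class of finite posets of width $w$. $\lg$ denotes the logarithm to base $2$. *)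

(* Defs.v *)
From mathcomp Require Import all_boot all_order all_algebra.
From mathcomp Require Import classical_sets reals constructive_ereal ereal exp.

Set Implicit Arguments.
Unset Strict Implicit.
Unset Printing Implicit Defensive.

Import Order.TTheory GRing.Theory Num.Theory.

Definition antichain d (V : finPOrderType d) (S : {set V}) : bool :=
  [forall x in S, forall y in S, (x != y) ==> (x >< y)%O].

Definition width d (V : finPOrderType d) : nat :=
  \max_(S : {set V} | antichain S) #|S|.

(* Strict linear orders, as sets of pairs so that they form a finite type. *)
Definition strict_linear (V : finType) (r : {set V * V}) : bool :=
  [&& [forall x, (x, x) \notin r],
      [forall x, forall y, forall z,
         ((x, y) \in r) && ((y, z) \in r) ==> ((x, z) \in r)]
    & [forall x, forall y, (x != y) ==> ((x, y) \in r) || ((y, x) \in r)]].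

Definition presentation (V : finType) : finType :=
  {r : {set V * V} | strict_linear r}.

Definition prec (V : finType) (s : presentation V) : rel V :=
  fun x y => (x, y) \in sval s.

Definition preceq (V : finType) (s : presentation V) : rel V :=
  fun x y => (x == y) || prec s x y.

Definition initial (V : finType) (s : presentation V) (v : V) : Type :=
  {x : V | preceq s x v}.

(* The posets induced on the vertices presented up to and including v
   (resp. w) are isomorphic as on-line posets; such an isomorphism maps
   v to w, the last vertices presented. *)
Definition same_history d (V : finPOrderType d) d' (W : finPOrderType d')
    (s : presentation V) (v : V) (t : presentation W) (w : W) : Prop :=
  exists f : initial s v -> initial t w,
    [/\ bijective f,
        forall x y, (val (f x) <= val (f y))%O = (val x <= val y)%O
      & forall x y, prec t (val (f x)) (val (f y)) = prec s (val x) (val y)].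

(* Chains are named by natural numbers: C_i consists of the vertices with
   value i.  Invariance under isomorphism of histories says both that the
   names of the vertices carry no information and that the choice is
   irrevocable, since later vertices are not in the history. *)
Record algorithm : Type := Algorithm {
  assign : forall d (V : finPOrderType d), presentation V -> V -> nat;
  assign_chain : forall d (V : finPOrderType d) (s : presentation V) (x y : V),
    assign s x = assign s y -> (x >=< y)%O;
  assign_online : forall d (V : finPOrderType d) d' (W : finPOrderType d')
      (s : presentation V) (v : V) (t : presentation W) (w : W),
    same_history s v t w -> assign s v = assign t w }.

Definition chi_online (A : algorithm) d (V : finPOrderType d)
    (s : presentation V) : nat :=
  size (undup [seq assign A s v | v : V]).

Definition chi (A : algorithm) d (V : finPOrderType d) : nat :=
  \max_(s : presentation V) chi_online A s.

Local Open Scope ring_scope.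
Local Open Scope classical_set_scope.

(* A maximum over all posets of width w need not exist, so values are taken
   in the extended reals.  As the sets below consist of natural numbers and
   possibly +oo, and are nonempty for w > 0, a finite supremum is a maximum
   and the infimum is always a minimum. *)
Definition val_alg (R : realType) (A : algorithm) (w : nat) : \bar R :=
  ereal_sup [set x | exists d (V : finPOrderType d),
    width V = w /\ x = ((chi A V)%:R)%:E].

Definition online_val (R : realType) (w : nat) : \bar R :=
  ereal_inf [set x | exists A : algorithm, x = val_alg R A w].

Definition lg (R : realType) (x : R) : R := ln x / ln 2.

(* Main.v *)
Require Import Defs.
From mathcomp Require Import all_boot all_order all_algebra.
From mathcomp Require Import boolp reals sequences exp.
From mathcomp Require Import zify ring lra.

Set Implicit Arguments.
Unset Strict Implicit.
Unset Printing Implicit Defensive.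

Import Order.TTheory GRing.Theory Num.Theory.

(** Split the vertices greedily into levels: [V_k] receives the vertices that
    complete an antichain of size [k] in [V_1 + ... + V_k], a poset of width [k].
    Each vertex of [V_k] is put in a maximum antichain, chosen so that these
    antichains stay linearly ordered. Keep a comparability between an antichain
    and its neighbours at insertion time only if it extends to a perfect
    matching; together these generate a suborder of width [k] on [V_k]. In it a
    ladder has at most [2 k^2] rungs, because the labels above a fixed vertex
    can only increase in number, and because a comparability factors through
    the oldest antichain it crosses. First-Fit is run on this suborder.

    On a poset of width [w] without ladders of length [m] First-Fit uses few
    colours. If the upper half of the colours has width [w1], an antichain of
    size [w1] in it is at least half incomparable to some vertex of each lower
    colour. Restricting the lower colours to what is incomparable to a common
    half [A] of it, and discarding all but a fraction [1 / (2 w^5 m^2)] of them,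
    leaves nested colour classes, on which the colouring is still First-Fit-like
    and the width is at most [w - w1 / 2]. Iterating gives
    [w ^ (5/2 lg w + 2 lg m + O(1))] colours, and [m = O(w^2)]. *)

(** * Chains and antichains *)

(** First-Fit alone has no bound in terms of the width: on posets of width 2 it can already use
    arbitrarily many chains. It is therefore run on a sparser order in which ladders stay short.
    Dropping comparabilities threatens to raise the width. Those lying in a perfect matching are the
    right ones to keep: matchings compose, an up-set cannot shrink along a matching, and the
    matching of equal labels in a Dilworth cover always survives, so that the labels remain chains.
    Origin of the exponent: each halving of the width costs a factor of about [w^5 m^2]. Over
    roughly [lg w] halvings the factors [(w / 2^i)^5] multiply to about [w^(5/2 lg w)], and the
    factors [m^2] to [w^(2 lg m)]. With [m] about [2 w^2] the latter adds [4 lg w] to the exponent,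
    hence 6.5. The number of levels is a further factor [w], absorbed in [C]. *)

Lemma chain_or_antichain (T : finType) (rho : rel T) (b n : nat) (X : {set T}) :
    b * n < #|X| ->
  (exists s, [/\ sorted rho s, size s = n.+1 & {subset s <= X}]) \/
  (exists Y : {set T}, [/\ Y \subset X, b < #|Y|
                         & {in Y &, forall x y, ~~ rho x y}]).
Proof.
elim: n X => [|n IHn] X ltX.
  have /card_gt0P[x xX] : 0 < #|X| by lia.
  by left; exists [:: x]; split=> // y; rewrite inE => /eqP->.
(* Peel off the elements without a predecessor: they are independent, and a path found among the
   others can be prolonged at its head. Nothing is assumed of [rho], so the path may repeat
   elements; where distinctness matters it comes from transitivity and irreflexivity. *)
pose M := [set x in X | [forall y in X, ~~ rho y x]].
have sMX : M \subset X by apply/subsetP=> x; rewrite inE => /andP[].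
have [leM | ltM] := leqP #|M| b; last first.
  right; exists M; split=> // x y; rewrite !inE => /andP[xX _] /andP[_].
  by move/forall_inP; apply.
have cXM : b * n < #|X :\: M| by rewrite cardsDS //; lia.
have [[s [s_sorted size_s sX]] | [Y [sYX ltY antiY]]] := IHn _ cXM; last first.
  by right; exists Y; split=> //; apply: subset_trans sYX (subsetDl _ _).
left; case: s => // x s in s_sorted size_s sX *.
have := sX x (mem_head _ _); rewrite !inE => /andP[+ xX]; rewrite xX /=.
rewrite negb_forall => /existsP[y]; rewrite negb_imply negbK => /andP[yX yx].
exists [:: y, x & s]; split=> [||z]; first by rewrite /= yx.
  by rewrite /= -size_s.
by rewrite inE => /predU1P[-> // | /sX]; rewrite inE => /andP[].
Qed.

(** * Dilworth's theorem *)

Section Dilworth.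
Variables (T : finType) (le : rel T).
Hypotheses (lexx : reflexive le) (le_anti : antisymmetric le)
           (le_trans : transitive le).

Definition antichain_in (X S : {set T}) : Prop :=
  S \subset X /\ {in S &, forall x y, le x y -> x = y}.

Lemma maximal_element (X : {set T}) : X != set0 ->
  exists2 a, a \in X & {in X, forall y, le a y -> y = a}.
Proof.
case/set0Pn=> x0 x0X.
pose up x := [set y in X | le x y].
have [a aX0 amin] := @arg_minnP _ x0 [in X] (fun x => #|up x|) x0X.
have aX : a \in X := aX0.
exists a => // y yX ay; apply/eqP/negPn/negP=> nya.
suff: #|up y| < #|up a| by rewrite ltnNge amin.
apply/proper_card/properP; split.
  by apply/subsetP=> z; rewrite !inE => /andP[-> /(le_trans ay)].
exists a; rewrite !inE aX ?lexx //=; apply: contraNN nya => ya.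
by apply/eqP/le_anti; rewrite ya.
Qed.

(** Galvin's induction: delete a maximal [a], cover the rest by [k] chains, and in each take the
    topmost element that lies in an antichain of size [k]. These tops form an antichain, so [a] lies
    above one of them. Cutting out [a] together with the part of that chain up to its top destroys
    every antichain of size [k]. *)
Lemma dilworth (k : nat) (X : {set T}) :
    (forall S, antichain_in X S -> #|S| <= k) ->
  exists c : T -> nat, {in X, forall x, c x < k} /\
    {in X &, forall x y, c x = c y -> le x y || le y x}.
Proof.
have [n] := ubnP #|X|; elim: n k X => // n IHn k X /ltnSE leXn wX.
have [->|/[dup] X_neq0 /maximal_element [a aX amax]] := eqVneq X set0.
  by exists (fun=> 0); split=> [x|x y]; rewrite inE.
have k_gt0 : 0 < k.
  rewrite -(cards1 a); apply: wX; split; first by rewrite sub1set.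
  by move=> x y; rewrite !inE => /eqP-> /eqP->.
(* It suffices to find a chain through [a] whose removal lowers the width; that chain receives the
   last colour [k.-1]. *)
have IHK (K : {set T}) : a \in K -> K \subset X ->
    {in K &, forall x y, le x y || le y x} ->
    (forall S, antichain_in (X :\: K) S -> #|S| < k) ->
  exists c : T -> nat, {in X, forall x, c x < k} /\
    {in X &, forall x y, c x = c y -> le x y || le y x}.
  move=> aK sKX Kchain wK.
  have [||c [ltc cP]] := IHn k.-1 (X :\: K).
  - apply: leq_trans leXn; apply: proper_card; apply/properP.
    by split; [apply: subsetDl | exists a; rewrite // inE aK].
  - by move=> S /wK; lia.
  exists (fun x => if x \in K then k.-1 else c x); split=> [x xX|x y xX yX].
    by case: ifP => xK; [lia | have := ltc x; rewrite inE xK xX => /(_ isT); lia].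
  case: ifP => xK; case: ifP => yK; first by move=> _; apply: Kchain.
  - by move=> cy; have := ltc y; rewrite inE yK yX -cy ltnn => /(_ isT).
  - by move=> cx; have := ltc x; rewrite inE xK xX cx ltnn => /(_ isT).
  - by apply: cP; rewrite inE ?xK ?yK.
pose X' := X :\ a.
have [/existsP[S0] | noS] := boolP [exists S : {set T},
    [&& S \subset X', #|S| == k & [forall x in S, forall y in S, le x y ==> (x == y)]]];
  last first.
  apply: (IHK [set a]); rewrite ?set11 ?sub1set //.
    by move=> x y; rewrite !inE => /eqP-> /eqP->; rewrite lexx.
  move=> S [sSX antiS]; rewrite ltn_neqAle wX ?andbT; last first.
    by split=> //; apply: subset_trans sSX (subsetDl _ _).
  apply: contraNN noS => cS; apply/existsP; exists S; rewrite sSX cS /=.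
  by apply/forall_inP=> x xS; apply/forall_inP=> y yS; apply/implyP=> /antiS->.
case/and3P=> sS0 /eqP cS0 /forall_inP aS0.
have [||c [ltc cP]] := IHn k X'.
- by rewrite (cardsD1 a) aX in leXn.
- move=> S [sSX antiS]; apply: wX; split=> //.
  exact: subset_trans sSX (subsetDl _ _).
pose big (S : {set T}) := [&& S \subset X', #|S| == k
  & [forall x in S, forall y in S, le x y ==> (x == y)]].
have bigP S : big S -> [/\ {subset S <= X'}, #|S| = k &
    {in S &, forall x y, le x y -> x = y}].
  case/and3P=> /subsetP sS /eqP cS /forall_inP aS; split=> // x y xS yS.
  by have /forall_inP/(_ y yS)/implyP xy := aS x xS; move=> /xy/eqP.
have bigS0 : big S0 by rewrite /big sS0 cS0 eqxx /=; apply/forall_inP.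
have hit S i : big S -> i < k -> exists2 x, x \in S & c x = i.
  case/bigP=> sS cS aS ltik.
  have cinj : {in S &, injective c}.
    by move=> x y xS yS /(cP _ _ (sS _ xS) (sS _ yS))/orP[]/aS->.
  suff: i \in [seq c x | x in S] by case/imageP=> x xS ->; exists x.
  have Uc : uniq [seq c x | x in S].
    by rewrite map_inj_in_uniq ?enum_uniq // => x y; rewrite !mem_enum; apply: cinj.
  have sc : {subset [seq c x | x in S] <= iota 0 k}.
    by move=> j /imageP[x xS ->]; rewrite mem_iota /=; apply/ltc/sS.
  have [|_ ->] := uniq_min_size Uc sc; first by rewrite size_iota size_image cS.
  by rewrite mem_iota.
pose cand i x := [exists S : {set T}, big S && (x \in S)] && (c x == i).
have top i : i < k -> exists x, cand i x /\ forall y, cand i y -> le y x.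
  move=> ltik; have [x xS cx] := hit _ _ bigS0 ltik.
  have [|y] := @maximal_element [set x | cand i x].
    apply/set0Pn; exists x; rewrite inE /cand cx eqxx andbT.
    by apply/existsP; exists S0; rewrite bigS0.
  rewrite inE => cy ymax; exists y; split=> // z cz.
  have inX' t : cand i t -> t \in X' /\ c t = i.
    by case/andP=> /existsP[S /andP[/bigP[sS _ _] /sS]] ? /eqP.
  have [[yX cyi] [zX czi]] := (inX' _ cy, inX' _ cz).
  have /orP[yz|//] := cP _ _ yX zX (etrans cyi (esym czi)).
  by rewrite (ymax z) ?inE.
have [x xP] : exists x : nat -> T, forall i, i < k ->
    cand i (x i) /\ forall y, cand i y -> le y (x i).
  have /fin_all_exists [f fP] : forall i : 'I_k, exists x,
      cand i x /\ forall y, cand i y -> le y x.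
    by move=> i; apply: top.
  exists (fun i => if insub i is Some j then f j else a) => i ltik.
  by rewrite (insubT (fun i => i < k) ltik); apply: (fP (Ordinal ltik)).
pose xs := [set x (i : 'I_k) | i : 'I_k].
have xinX' i : i < k -> x i \in X' /\ c (x i) = i.
  by case/xP=> /andP[/existsP[S /andP[/bigP[sS _ _] /sS]] ? /eqP].
have xanti i j : i < k -> j < k -> le (x i) (x j) -> i = j.
  move=> ltik ltjk xij; have [/andP[/existsP[S /andP[bigS xjS]] cj] _] := xP _ ltjk.
  have [y yS cy] := hit _ _ bigS ltik.
  have yx : le y (x i).
    case: (xP _ ltik) => _; apply; rewrite /cand cy eqxx andbT.
    by apply/existsP; exists S; rewrite bigS.
  have [_ _ aS] := bigP _ bigS.
  by rewrite -cy (aS y (x j)) ?(le_trans yx) //; apply/eqP.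
have cxs : #|xs| = k.
  rewrite card_imset ?card_ord // => i j xij; apply: val_inj.
  by apply: xanti; rewrite //= xij lexx.
have [i ltik xia] : exists2 i, i < k & le (x i) a.
  case: (boolP [exists i : 'I_k, le (x i) a]) => [/existsP[i xi]|no].
    by exists i.
  suff: #|a |: xs| <= k.
    rewrite cardsU1 cxs; case: imsetP => [[i _ ai]|_]; last by lia.
    by have [] := xinX' i (ltn_ord i); rewrite -ai !inE eqxx.
  apply: wX; split.
    apply/subsetP=> y /setU1P[-> // | /imsetP[i _ ->]].
    by have [] := xinX' i (ltn_ord i); rewrite inE => /andP[].
  move=> y z /setU1P[->|/imsetP[i _ ->]] /setU1P[->|/imsetP[j _ ->]] //.
  - by move/amax=> -> //; have [] := xinX' j (ltn_ord j); rewrite inE => /andP[].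
  - by move=> xi; case/negP: no; apply/existsP; exists i.
  - by move/xanti=> -> .
have [xiX cxi] := xinX' _ ltik.
apply: (IHK (a |: [set y in X' | (c y == i) && le y (x i)])).
- exact: setU11.
- apply/subsetP=> y /setU1P[-> //|]; rewrite !inE => /andP[]. by case/andP.
- move=> y z /setU1P[->|]; last first.
    rewrite inE => /and3P[yX /eqP cy yx] /setU1P[->|].
      by rewrite (le_trans yx).
    by rewrite inE => /and3P[zX /eqP cz zx]; apply: cP; rewrite // cy.
  case/setU1P=> [->|]; first by rewrite lexx.
  by rewrite inE => /and3P[zX _ zx]; rewrite (le_trans zx) ?orbT.
(* An antichain of size [k] that avoids [a] meets colour [i] at or below the top [x i], that is,
   inside the removed chain. *)
move=> S [sSX antiS]; rewrite ltn_neqAle wX ?andbT; last first.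
  by split=> //; apply: subset_trans sSX (subsetDl _ _).
apply/negP=> cS.
have sSX' : S \subset X'.
  apply: subset_trans sSX _; apply/subsetP=> y.
  by rewrite !inE negb_or => /andP[/andP[-> _] ->].
have bigS : big S.
  rewrite /big sSX' cS /=.
  by apply/forall_inP=> u uS; apply/forall_inP=> y yS; apply/implyP=> /antiS->.
have [y yS cy] := hit _ _ bigS ltik.
have yx : le y (x i).
  case: (xP _ ltik) => _; apply; rewrite /cand cy eqxx andbT.
  by apply/existsP; exists S; rewrite bigS.
have := subsetP sSX _ yS; rewrite !inE yx cy eqxx andbT.
by have := subsetP sSX' _ yS; rewrite !inE => ->; rewrite orbT.
Qed.

End Dilworth.

(** * First-Fit on ladder-free posets *)

Section Orders.
Variable T : finType.

Definition inc (lt : rel T) : rel T :=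
  fun x y => [&& x != y, ~~ lt x y & ~~ lt y x].

Definition width_le (lt : rel T) (Q : {set T}) (w : nat) : Prop :=
  forall S : {set T}, S \subset Q -> {in S &, forall x y, ~~ lt x y} -> #|S| <= w.

(** For a strict order: [u i] lies below [z j] exactly when [i <= j], and the two sides are
    otherwise incomparable. *)
Definition ladder (lt : rel T) (m : nat) : Prop :=
  exists u z : nat -> T,
  [/\ forall i j, i < j -> j < m -> lt (u i) (u j) && lt (z i) (z j),
      forall i, i < m -> lt (u i) (z i),
      forall i j, i < j -> j < m -> ~~ lt (u j) (z i)
    & forall i j, i < m -> j < m -> ~~ lt (z i) (u j) && (z i != u j)].

Definition rev_rel (lt : rel T) : rel T := fun x y => lt y x.

Lemma rev_rel_trans lt : transitive lt -> transitive (rev_rel lt).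
Proof. by move=> tr y x z; rewrite /rev_rel => xy yz; apply: tr yz xy. Qed.

Lemma inc_rev lt x y : inc (rev_rel lt) x y = inc lt x y.
Proof. by rewrite /inc /rev_rel [~~ lt y x && _]andbC. Qed.

Lemma width_le_rev lt Q w : width_le lt Q w -> width_le (rev_rel lt) Q w.
Proof. by move=> wQ S sSQ aS; apply: wQ => // x y xS yS; apply: aS. Qed.

Lemma ladder_rev lt m : ladder (rev_rel lt) m -> ladder lt m.
Proof.
case=> u [z [uz_mono rung no_up no_dn]].
exists (fun i => z (m.-1 - i)), (fun i => u (m.-1 - i)); split.
- move=> i j ij jm; rewrite andbC.
  by apply: (uz_mono (m.-1 - j) (m.-1 - i)); lia.
- by move=> i im; apply: rung; lia.
- by move=> i j ij jm; apply: no_up; lia.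
- by move=> i j im jm; rewrite eq_sym; apply: no_dn; lia.
Qed.

End Orders.

Section TopsLadder.
Variables (T : finType) (lt : rel T) (M : nat) (col : T -> 'I_M).
Hypotheses (lt_irr : irreflexive lt) (lt_trans : transitive lt).

(* [t k] is the top of the part of colour [k] that is incomparable to [A];
   the witness of [t j] in a smaller colour [k] then lies above [A]. *)
Lemma tops_ladder (w m : nat) (Q A : {set T}) (t : 'I_M -> T) (ks : seq 'I_M) :
    0 < w -> 0 < m -> width_le lt Q w ->
    sorted (fun k j : 'I_M => (k < j) && lt (t k) (t j)) ks -> w * m < size ks ->
    {in ks &, forall k j : 'I_M, k < j -> lt (t k) (t j) ->
       exists2 z, z \in Q & [/\ col z = k, lt (t k) z, inc lt (t j) z &
                                exists2 a, a \in A & lt a z]} ->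
    {in ks, forall k, {in A, forall a, ~~ lt a (t k)}} ->
  ladder lt m.
Proof.
move=> w_gt0 m_gt0 wQ ks_sorted size_ks wit noA.
case: ks ks_sorted size_ks wit noA => [|k0 ks'] //; set ks := k0 :: ks'.
move=> ks_sorted size_ks wit noA.
pose kap := nth k0 ks.
have kap_in i : i <= w * m -> kap i \in ks by move=> le_i; apply/mem_nth/(leq_ltn_trans le_i).
have kap_lt i j : i < j -> j <= w * m -> (kap i < kap j) && lt (t (kap i)) (t (kap j)).
  move=> ij jn.
  have tr : transitive (fun k j : 'I_M => (k < j) && lt (t k) (t j)).
    by move=> y x z /andP[xy txy] /andP[/(ltn_trans xy)-> /(lt_trans txy)->].
  by apply: (sorted_ltn_nth tr) => //; rewrite inE; apply: leq_ltn_trans size_ks; lia.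
(* Each pair of consecutive tops yields a vertex above the first and incomparable to the second. Of
   these [w * m] vertices, [m] form a chain, which becomes the other side of the ladder. *)
have /fin_all_exists[zf zfP] : forall i : 'I_(w * m), exists z,
    [/\ z \in Q, col z = kap i, lt (t (kap i)) z, inc lt (t (kap i.+1)) z &
        exists2 a, a \in A & lt a z].
  move=> [i lti] /=; have /andP[k1 k2] := kap_lt i i.+1 (leqnn _) lti.
  have [] := wit _ _ (kap_in _ (ltnW lti)) (kap_in _ lti) k1 k2.
  by move=> z zQ [] *; exists z; split.
have tle i j : i <= j -> j <= w * m -> (t (kap i) == t (kap j)) || lt (t (kap i)) (t (kap j)).
  by case: ltngtP => // [ij _ /(kap_lt _ _ ij)/andP[_ ->]|-> _]; rewrite ?orbT ?eqxx.
have zf_up (i j : 'I_(w * m)) : i < j -> ~~ lt (t (kap j)) (zf i).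
  move=> ij; have [_ _ _ /and3P[_ no _] _] := zfP i; apply: contraNN no => tz.
  by have /orP[/eqP->|/lt_trans->] := tle _ _ ij (ltnW (ltn_ord j)).
have zf_dn (i j : 'I_(w * m)) : ~~ lt (zf i) (t (kap j)) && (zf i != t (kap j)).
  have [_ _ _ _ [a aA az]] := zfP i.
  have noaj := noA _ (kap_in _ (ltnW (ltn_ord j))) a aA.
  by apply/andP; split; [apply: contraNN noaj => /(lt_trans az) | apply: contraNN noaj => /eqP<-].
have zf_lt (i j : 'I_(w * m)) : lt (zf i) (zf j) -> i < j.
  move=> zij; have [_ _ tz_i /and3P[_ no_i no_i'] [a aA az]] := zfP i.
  case: ltngtP => // [ji|/val_inj ij]; last by rewrite ij lt_irr in zij.
  by have := zf_up _ _ ji; rewrite (lt_trans tz_i zij).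
have wm1 : w * m.-1 < #|[set: 'I_(w * m)]| by rewrite cardsT card_ord ltn_pmul2l //; lia.
have [[s [s_sorted size_s _]]|[Y [_ ltY Yanti]]] :=
    chain_or_antichain (fun i j : 'I_(w * m) => lt (zf i) (zf j)) wm1; last first.
  have kap_inj i j : i < w * m -> j < w * m -> kap i = kap j -> i = j.
    move=> im jm E; case: (ltngtP i j) => // ij.
      by have := kap_lt _ _ ij (ltnW jm); rewrite E ltnn.
    by have := kap_lt _ _ ij (ltnW im); rewrite E ltnn.
  have zf_inj : injective zf.
    move=> i j E; apply: val_inj; apply: (kap_inj i j (ltn_ord i) (ltn_ord j)).
    have [_ ci _ _ _] := zfP i; have [_ cj _ _ _] := zfP j.
    by rewrite -ci E cj.
  suff : #|zf @: Y| <= w by rewrite card_imset // leqNgt ltY.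
  apply: wQ.
    by apply/subsetP=> z /imsetP[i _ ->]; have [] := zfP i.
  by move=> z z' /imsetP[i iY ->] /imsetP[j jY ->]; apply: Yanti.
case: s s_sorted size_s => [//|s0 s']; set s := s0 :: s' => s_sorted size_s.
pose sg i := nth s0 s i.
have sg_lt i j : i < j -> j < m -> lt (zf (sg i)) (zf (sg j)).
  move=> ij jm; have tr : transitive (fun i j : 'I_(w * m) => lt (zf i) (zf j)).
    by move=> y x z; apply: lt_trans.
  by apply: (sorted_ltn_nth tr) => //; rewrite inE size_s; lia.
exists (fun i => t (kap (sg i))), (fun i => zf (sg i)); split.
- move=> i j ij jm; rewrite sg_lt // andbT.
  have := zf_lt _ _ (sg_lt _ _ ij jm) => sij.
  by have /andP[] := kap_lt _ _ sij (ltnW (ltn_ord _)).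
- by move=> i _; have [] := zfP (sg i).
- by move=> i j ij jm; apply/zf_up/zf_lt/sg_lt.
- by move=> i j _ _; apply: zf_dn.
Qed.

End TopsLadder.

Section Thin.
Variables (T : finType) (lt : rel T) (M : nat) (col : T -> 'I_M).
Hypotheses (lt_irr : irreflexive lt) (lt_trans : transitive lt).

(** Too long an increasing chain of tops gives a ladder, and [w + 1] pairwise incomparable tops
    exceed the width. Two applications of [chain_or_antichain] leave only a long chain whose tops go
    down as the colour goes up. *)
Lemma decreasing_tops (w m b : nat) (Q A : {set T}) (t : 'I_M -> T) (S : {set 'I_M}) :
    0 < w -> 0 < m -> width_le lt Q w -> ~ ladder lt m ->
    {in S, forall k, t k \in Q /\ col (t k) = k} ->
    {in S &, forall k j : 'I_M, k < j -> lt (t k) (t j) ->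
       exists2 z, z \in Q & [/\ col z = k, lt (t k) z, inc lt (t j) z &
                                exists2 a, a \in A & lt a z]} ->
    {in S, forall k, {in A, forall a, ~~ lt a (t k)}} ->
    (w * b) * (w * m) < #|S| ->
  exists X : {set 'I_M}, [/\ X \subset S, b < #|X|
    & {in X &, forall k j : 'I_M, k < j -> lt (t j) (t k)}].
Proof.
move=> w_gt0 m_gt0 wQ noL tP wit noA ltS.
have [[ks [ks_sorted size_ks ksS]]|[Y [sYS ltY Yanti]]] :=
    chain_or_antichain (fun k j : 'I_M => (k < j) && lt (t k) (t j)) ltS.
  case: noL; apply: (tops_ladder lt_irr lt_trans w_gt0 m_gt0 wQ ks_sorted).
  - by rewrite size_ks.
  - by move=> k j /ksS kS /ksS jS; apply: wit.
  - by move=> k /ksS; apply: noA.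
have YS := subsetP sYS.
have [[ks [ks_sorted size_ks ksY]]|[Z [sZY ltZ Zanti]]] :=
    chain_or_antichain (fun k j : 'I_M => (k < j) && lt (t j) (t k)) ltY.
  have tr : transitive (fun k j : 'I_M => (k < j) && lt (t j) (t k)).
    move=> y x z /andP[xy txy] /andP[yz tyz].
    by rewrite (ltn_trans xy yz) (lt_trans tyz txy).
  have irr : irreflexive (fun k j : 'I_M => (k < j) && lt (t j) (t k)).
    by move=> x; rewrite ltnn.
  exists [set x in ks]; split.
  - by apply/subsetP=> x; rewrite inE => /ksY/YS.
  - have /card_uniqP cks : uniq ks by apply: sorted_uniq tr irr _ ks_sorted.
    by rewrite cardsE cks size_ks.
  - move=> k j; rewrite !inE => kks jks kj.
    have neq : k != j by apply: contraTneq kj => ->; rewrite ltnn.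
    case: (ltngtP (index k ks) (index j ks)) => idx.
    + have := sorted_ltn_index tr ks_sorted _ _ kks jks idx.
      by case/andP.
    + have := sorted_ltn_index tr ks_sorted _ _ jks kks idx.
      by rewrite ltnNge ltnW.
    + by rewrite -(nth_index k kks) idx nth_index // eqxx in neq.
have t_inj : {in Z &, injective t}.
  move=> k j /(subsetP sZY)/YS kS /(subsetP sZY)/YS jS E.
  have [_ ck] := tP _ kS; have [_ cj] := tP _ jS.
  by rewrite -ck -cj E.
suff : #|t @: Z| <= w by rewrite (card_in_imset t_inj) leqNgt ltZ.
apply: wQ.
  by apply/subsetP=> z /imsetP[i /(subsetP sZY)/YS/tP[? _] ->].
move=> z z' /imsetP[k kZ ->] /imsetP[j jZ ->].
have kY := subsetP sZY _ kZ; have jY := subsetP sZY _ jZ.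
case: (ltngtP k j) => [kj|jk|/val_inj->]; last by rewrite lt_irr.
  by have := Yanti _ _ kY jY; rewrite kj.
by have := Zanti _ _ jZ kZ; rewrite jk.
Qed.

End Thin.

(* What First-Fit guarantees about its colouring of [Q], for the colours in [S]. *)
Definition grundy (T : finType) (M : nat) (col : T -> 'I_M) (lt : rel T)
    (Q : {set T}) (S : {set 'I_M}) : Prop :=
  [/\ {in S, forall j, exists2 u, u \in Q & col u = j},
      {in Q &, forall u v, col u = col v -> [|| u == v, lt u v | lt v u]}
    & {in Q, forall u, {in S, forall k : 'I_M, k < col u ->
        exists2 z, z \in Q & col z = k /\ inc lt u z}}].

Section MaximalElement.
Variables (T : finType) (lt : rel T).
Hypotheses (lt_irr : irreflexive lt) (lt_trans : transitive lt).

Lemma maximal_in (X : {set T}) : X != set0 ->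
  exists2 a, a \in X & {in X, forall y, ~~ lt a y}.
Proof.
move=> X0; pose le x y := (x == y) || lt x y.
have [|||a aX amax] := @maximal_element T le _ _ _ X X0.
- by move=> x; rewrite /le eqxx.
- move=> x y /andP[/predU1P[//|xy] /predU1P[//|yx]].
  by have := lt_trans xy yx; rewrite lt_irr.
- move=> y x z /predU1P[->//|xy] /predU1P[<-|yz]; first by rewrite /le xy orbT.
  by rewrite /le (lt_trans xy yz) orbT.
exists a => // y yX; apply/negP=> ay; have := ay.
by rewrite (amax y yX) ?lt_irr // /le ay orbT.
Qed.

End MaximalElement.

(** * Nested colour classes *)

Section Restrict.
Variables (T : finType) (M : nat) (col : T -> 'I_M) (lt : rel T).
Hypotheses (lt_irr : irreflexive lt) (lt_trans : transitive lt).

Definition part (Q A : {set T}) (j : 'I_M) : {set T} :=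
  [set u in Q | (col u == j) && [forall a in A, inc lt u a]].

(** Applied to the tops and, in the reversed order, to the bottoms of the parts, [decreasing_tops]
    leaves colours whose intervals from [s k] to [t k] are nested, smaller colours outermost. A
    First-Fit witness of colour [k] for an element of a larger colour is then trapped between [s k]
    and [t k]. As these are incomparable to [A], so is the witness, and the restricted colouring is
    again [grundy]. *)
Lemma grundy_restrict (w m f : nat) (Q A : {set T}) (S : {set 'I_M}) :
    0 < w -> 0 < m -> width_le lt Q w -> ~ ladder lt m -> A \subset Q -> grundy col lt Q S ->
    {in S, forall j, part Q A j != set0} ->
    (forall (Q' : {set T}) (S' : {set 'I_M}), Q' \subset Q -> {in Q' & A, forall u a, inc lt u a} ->
       grundy col lt Q' S' -> #|S'| <= f) ->
  #|S| <= w * (w * f * (w * m)) * (w * m).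
Proof.
move=> w_gt0 m_gt0 wQ noL sAQ [g1 g2 g3] part0 IH.
have irr' : irreflexive (rev_rel lt) := lt_irr.
have tr' := rev_rel_trans lt_trans.
rewrite leqNgt; apply/negP=> ltS.
have [x0 x0Q] : exists x0, x0 \in Q.
  have /card_gt0P[j /g1[u uQ _]] : 0 < #|S| by apply: leq_ltn_trans ltS.
  by exists u.
have partP j u : reflect [/\ u \in Q, col u = j & {in A, forall a, inc lt u a}] (u \in part Q A j).
  apply: (iffP idP); first by rewrite inE => /and3P[-> /eqP-> /forall_inP ?]; split.
  by case=> uQ cu uA; rewrite inE uQ cu eqxx; apply/forall_inP.
have [t tP] : exists t : 'I_M -> T, {in S, forall j,
    t j \in part Q A j /\ {in part Q A j, forall y, ~~ lt (t j) y}}.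
  have /fin_all_exists[t tP] : forall j, exists x, j \in S ->
    x \in part Q A j /\ {in part Q A j, forall y, ~~ lt x y}.
    move=> j; have [jS|_] := boolP (j \in S); last by exists x0.
    by have [x ? ?] := maximal_in lt_irr lt_trans (part0 _ jS); exists x.
  by exists t.
have [s sP] : exists s : 'I_M -> T, {in S, forall j,
    s j \in part Q A j /\ {in part Q A j, forall y, ~~ lt y (s j)}}.
  have /fin_all_exists[s sP] : forall j, exists x, j \in S ->
    x \in part Q A j /\ {in part Q A j, forall y, ~~ lt y x}.
    move=> j; have [jS|_] := boolP (j \in S); last by exists x0.
    by have [x ? ?] := maximal_in irr' tr' (part0 _ jS); exists x.
  by exists s.
have [||||X [sXS ltX Xdec]] := @decreasing_tops T lt M col lt_irr lt_trans w m
    (w * f * (w * m)) Q A t S w_gt0 m_gt0 wQ noL.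
- by move=> k kS; have [/partP[]] := tP _ kS.
- move=> k j kS jS kj tkj.
  have [/partP[tkQ ck tkA] tk_max] := tP _ kS; have [/partP[tjQ cj tjA] _] := tP _ jS.
  have [|z zQ [cz tjz]] := g3 _ tjQ _ kS; first by rewrite cj.
  have tkz : lt (t k) z.
    have /and3P[_ n1 n2] := tjz.
    have /or3P[/eqP E|//|ztk] := g2 _ _ tkQ zQ (etrans ck (esym cz)).
      by rewrite -E tkj in n2.
    by rewrite (lt_trans ztk tkj) in n2.
  exists z => //; split=> //.
  (* Being above the top of its part, [z] is comparable to some member of [A]; it cannot lie below
     that member, for then [t k] would too. *)
  have : z \notin part Q A k by apply: contraL tkz => /tk_max.
  rewrite inE zQ cz eqxx /= negb_forall => /existsP[a]; rewrite negb_imply => /andP[aA].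
  have /and3P[tka n1 n2] := tkA _ aA.
  rewrite /inc !negb_and !negbK => /or3P[/eqP E|za|az]; last by exists a.
    by rewrite -E tkz in n1.
  by rewrite (lt_trans tkz za) in n1.
- by move=> k kS a aA; have [/partP[_ _ /(_ a aA)/and3P[]]] := tP _ kS.
- by [].
have XS := subsetP sXS.
have [||||Z [sZX ltZ Zinc]] := @decreasing_tops T (rev_rel lt) M col irr' tr' w m
    f Q A s X w_gt0 m_gt0 (width_le_rev wQ) (fun l => noL (ladder_rev l)).
- by move=> k /XS kS; have [/partP[]] := sP _ kS.
- move=> k j /XS kS /XS jS kj; rewrite /rev_rel => tkj.
  have [/partP[tkQ ck tkA] tk_max] := sP _ kS; have [/partP[tjQ cj tjA] _] := sP _ jS.
  have [|z zQ [cz tjz]] := g3 _ tjQ _ kS; first by rewrite cj.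
  have tkz : lt z (s k).
    have /and3P[_ n1 n2] := tjz.
    have /or3P[/eqP E|ztk|//] := g2 _ _ tkQ zQ (etrans ck (esym cz)).
      by rewrite -E tkj in n1.
    by rewrite (lt_trans tkj ztk) in n1.
  exists z => //; split=> //; first by rewrite inc_rev.
  have : z \notin part Q A k by apply: contraL tkz => /tk_max.
  rewrite inE zQ cz eqxx /= negb_forall => /existsP[a]; rewrite negb_imply => /andP[aA].
  have /and3P[tka n1 n2] := tkA _ aA.
  rewrite /inc !negb_and !negbK => /or3P[/eqP E|za|az]; [|by exists a|].
    by rewrite -E tkz in n2.
  by rewrite (lt_trans az tkz) in n2.
- by move=> k /XS kS a aA; have [/partP[_ _ /(_ a aA)/and3P[]]] := sP _ kS.
- by [].
have ZX := subsetP sZX; have ZS j : j \in Z -> j \in S by move/ZX/XS.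
pose Q' := \bigcup_(j in Z) part Q A j.
have Q'P u : u \in Q' -> u \in part Q A (col u) /\ col u \in Z.
  by case/bigcupP=> j jZ /[dup] /partP[_ -> _].
suff : #|Z| <= f by rewrite leqNgt ltZ.
apply: (IH Q').
- by apply/subsetP=> u /Q'P[/partP[]].
- by move=> u a /Q'P[/partP[_ _ uA] _]; apply: uA.
split=> [j jZ|u v /Q'P[/partP[uQ _ _] _] /Q'P[/partP[vQ _ _] _]|u].
- have [tj _] := tP _ (ZS _ jZ); exists (t j); last by case/partP: tj.
  by apply/bigcupP; exists j.
- exact: g2.
case/Q'P=> uI; set j := col u => jZ k kZ kj.
have [/partP[tkQ ck tkA] tk_max] := tP _ (ZS _ kZ).
have [/partP[skQ ck' skA] sk_max] := sP _ (ZS _ kZ).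
have [tj tj_max] := tP _ (ZS _ jZ); have [sj sj_min] := sP _ (ZS _ jZ).
have /partP[uQ _ uA] := uI.
have utk : lt u (t k).
  have := Xdec _ _ (ZX _ kZ) (ZX _ jZ) kj; have /partP[tjQ cj _] := tj.
  have /or3P[/eqP->//|/lt_trans h|] := g2 _ _ uQ tjQ (esym cj); first by apply: h.
  by rewrite (negPf (tj_max _ uI)).
have sku : lt (s k) u.
  have := Zinc _ _ kZ jZ kj; rewrite /rev_rel; have /partP[sjQ cj _] := sj.
  have /or3P[/eqP->//| |h /lt_trans->//] := g2 _ _ uQ sjQ (esym cj).
  by rewrite (negPf (sj_min _ uI)).
have [z zQ [cz uz]] := g3 _ uQ _ (ZS _ kZ) kj.
exists z; last by split.
apply/bigcupP; exists k => //; apply/partP; split=> // a aA.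
have /and3P[_ n1 n2] := uz.
have tka := tkA _ aA; have ska := skA _ aA.
have /or3P[/eqP<-//|tkz|ztk] := g2 _ _ tkQ zQ (etrans ck (esym cz)).
  by rewrite (lt_trans utk tkz) in n1.
have /or3P[/eqP<-//|skz|zsk] := g2 _ _ skQ zQ (etrans ck' (esym cz)); last first.
  by rewrite (lt_trans zsk sku) in n2.
have /and3P[_ tka1 tka2] := tka; have /and3P[_ ska1 ska2] := ska.
apply/and3P; split.
- by apply: contraNneq ska1 => <-.
- by apply: contraNN ska1 => /(lt_trans skz).
- by apply: contraNN tka2 => /lt_trans/(_ ztk).
Qed.

End Restrict.

(** * Trading half of an antichain for a smaller width *)

Section Step.
Variables (T : finType) (M : nat) (col : T -> 'I_M) (lt : rel T).
Hypotheses (lt_irr : irreflexive lt) (lt_trans : transitive lt).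

(** Let [p] be the last element of the chain of colour [j] below some member of [A], and [q] the
    next one. Nothing in [A] is below [p] or above [q]. A member above [p] has its witness at or
    above [q], so it is not below [q]. The members comparable to [p] and to [q] are thus disjoint,
    and one of the two sets is at most half of [A]. Without such a [p], the least element of the
    chain is incomparable to all of [A]. *)
Lemma mostly_incomparable (Q A : {set T}) (j : 'I_M) :
    {in Q &, forall u v, col u = col v -> [|| u == v, lt u v | lt v u]} ->
    (exists2 u, u \in Q & col u = j) ->
    {in A &, forall x y, ~~ lt x y} -> {in A, forall a, col a != j} ->
    {in A, forall a, exists2 z, z \in Q & col z = j /\ inc lt a z} ->
  exists g, [/\ g \in Q, col g = j, 2 * #|[set a in A | ~~ inc lt g a]| <= #|A|
    & {in A, forall a, ~~ lt a g} \/ {in A, forall a, ~~ lt g a}].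
Proof.
move=> chainQ [u0 u0Q cu0] antiA colA witA.
have irr' : irreflexive (rev_rel lt) := lt_irr.
have tr' := rev_rel_trans lt_trans.
pose C := [set u in Q | col u == j].
have CP u : reflect (u \in Q /\ col u = j) (u \in C).
  by rewrite inE; apply: (iffP andP) => -[? /eqP].
have chainC u v : u \in C -> v \in C -> [|| u == v, lt u v | lt v u].
  by case/CP=> uQ cu /CP[vQ cv]; apply: chainQ; rewrite ?cu.
have wit a : a \in A -> exists2 z, z \in C & inc lt a z.
  by move/witA=> [z zQ [cz az]]; exists z => //; apply/CP.
have compE g a : g \in C -> a \in A -> ~~ inc lt g a = lt g a || lt a g.
  case/CP=> _ cg aA; rewrite /inc !negb_and !negbK.
  have /negPf-> // : g != a by apply: contraNneq (colA _ aA) => <-; rewrite cg.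
pose X := [set u in C | [exists a in A, lt u a]].
have [X0 | /(maximal_in lt_irr lt_trans)[p]] := eqVneq X set0.
  have notX u a : u \in C -> a \in A -> ~~ lt u a.
    move=> uC aA; apply/negP=> ua; suff: u \in X by rewrite X0 inE.
    by rewrite inE uC; apply/exists_inP; exists a.
  have C0 : C != set0 by apply/set0Pn; exists u0; apply/CP.
  have [q qC q_min] := maximal_in irr' tr' C0.
  have [qQ cq] := CP _ qC; exists q; split=> //; last by right=> a aA; apply: notX.
  rewrite (_ : [set _ in _ | _] = set0) ?cards0 //; apply/setP=> a.
  rewrite !inE; apply/negP=> /andP[aA]; rewrite compE // (negPf (notX _ _ qC aA)) /=.
  move=> aq; have [z zC /and3P[_ az _]] := wit _ aA.
  have /or3P[/eqP E|qz|] := chainC _ _ qC zC; last exact/negP/q_min.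
    by rewrite -E aq in az.
  by rewrite (lt_trans aq qz) in az.
rewrite inE => /andP[pC /exists_inP[a0 a0A pa0]] p_max.
have [pQ cp] := CP _ pC.
have no_lt_p a : a \in A -> ~~ lt a p.
  by move=> aA; apply: contraNN (antiA _ _ aA a0A) => /lt_trans/(_ pa0).
have [leB | ltB] := leqP (2 * #|[set a in A | lt p a]|) #|A|.
  exists p; split=> //; last by left.
  congr (2 * _ <= _): leB; apply: eq_card => a; rewrite !inE.
  by case: (boolP (a \in A)) => //= aA; rewrite compE // (negPf (no_lt_p _ aA)) orbF.
pose B := [set a in A | lt p a].
have BP a : reflect (a \in A /\ lt p a) (a \in B) by rewrite inE; apply: andP.
pose Y := [set u in C | lt p u].
have witY a : a \in B -> exists2 z, z \in Y & inc lt a z.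
  case/BP=> aA pa; have [z zC az] := wit _ aA; exists z => //.
  rewrite inE zC /=; have /and3P[_ n1 n2] := az.
  have /or3P[/eqP E|//|zp] := chainC _ _ pC zC; first by rewrite -E pa in n2.
  by rewrite (lt_trans zp pa) in n2.
have Y0 : Y != set0.
  have /card_gt0P[a /witY[z zY _]] : 0 < #|B| by rewrite /B; lia.
  by apply/set0Pn; exists z.
have [q] := maximal_in irr' tr' Y0; rewrite inE => /andP[qC pq] q_min.
have [qQ cq] := CP _ qC.
have noq a : a \in A -> ~~ lt q a.
  move=> aA; apply/negP=> qa; have /p_max : q \in X.
    by rewrite inE qC; apply/exists_inP; exists a.
  by rewrite pq.
exists q; split=> //; last by right.
have : [set a in A | ~~ inc lt q a] \subset A :\: B.
  apply/subsetP=> a; rewrite in_set => /andP[aA]; rewrite compE // (negPf (noq _ aA)) /=.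
  move=> aq; rewrite in_setD aA andbT; apply/negP=> /witY[z zY /and3P[_ az _]].
  have zC : z \in C by move: zY; rewrite inE => /andP[].
  have /or3P[/eqP E|qz|] := chainC _ _ qC zC; last exact/negP/q_min.
    by rewrite -E aq in az.
  by rewrite (lt_trans aq qz) in az.
move/subset_leq_card; rewrite cardsDS; last by apply/subsetP=> a /BP[].
by move: ltB; rewrite -/B; lia.
Qed.

Lemma grundyS (Q : {set T}) (S S' : {set 'I_M}) :
  S' \subset S -> grundy col lt Q S -> grundy col lt Q S'.
Proof.
move/subsetP=> sS [g1 g2 g3]; split=> // [j /sS/g1 //|u uQ k /sS]; exact: g3.
Qed.

(** The factor 2 fixes the side of [A] on which the comparabilities of [g j] lie, a factor [w]
    passes to a chain of the [g j], and the rest is [grundy_restrict]. Along such a chain the sets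
    of comparable members of [A] are nested, so the complement of the largest one, still half of
    [A], serves all the colours at once. *)
Lemma grundy_step (w m f : nat) (Q A : {set T}) (S0 S1 : {set 'I_M}) :
    0 < w -> 0 < m -> width_le lt Q w -> ~ ladder lt m ->
    grundy col lt Q (S0 :|: S1) -> {in S0 & S1, forall i j : 'I_M, i < j} ->
    A \subset Q -> {in A, forall a, col a \in S1} -> {in A &, forall x y, ~~ lt x y} ->
    (forall (Q' : {set T}) (S' : {set 'I_M}), Q' \subset Q ->
       width_le lt Q' (w - uphalf #|A|) -> grundy col lt Q' S' -> #|S'| <= f) ->
  #|S0| <= w * (w * (w * f * (w * m)) * (w * m)) * 2.
Proof.
move=> w_gt0 m_gt0 wQ noL gQ S01 sAQ colA antiA IH.
have [g1 g2 g3] := gQ.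
set K := w * (w * f * (w * m)) * (w * m).
rewrite leqNgt; apply/negP=> ltS0.
have [x0 x0Q] : exists x0, x0 \in Q.
  have /card_gt0P[j jS] : 0 < #|S0| by apply: leq_ltn_trans ltS0.
  by have [|u uQ _] := g1 j; [rewrite inE jS | exists u].
pose cmp x := [set a in A | ~~ inc lt x a].
have [g gP] : exists g : 'I_M -> T, {in S0, forall j,
    [/\ g j \in Q, col (g j) = j, 2 * #|cmp (g j)| <= #|A|
      & {in A, forall a, ~~ lt a (g j)} \/ {in A, forall a, ~~ lt (g j) a}]}.
  have /fin_all_exists[g gP] : forall j, exists x, j \in S0 ->
    [/\ x \in Q, col x = j, 2 * #|cmp x| <= #|A|
      & {in A, forall a, ~~ lt a x} \/ {in A, forall a, ~~ lt x a}].
    move=> j; have [jS|_] := boolP (j \in S0); last by exists x0.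
    have jS' : j \in S0 :|: S1 by rewrite inE jS.
    have [|a aA|a aA|x xP] := mostly_incomparable g2 _ antiA _ _ (j := j).
    - by have [u uQ cu] := g1 _ jS'; exists u.
    - by apply: contraTneq (S01 _ _ jS (colA _ aA)) => ->; rewrite ltnn.
    - have aQ := subsetP sAQ _ aA.
      by have [z zQ [cz az]] := g3 _ aQ _ jS' (S01 _ _ jS (colA _ aA)); exists z.
    by exists x.
  by exists g.
pose up := [set j in S0 | [forall a in A, ~~ lt a (g j)]].
have [Z [sZS ltZ nested]] : exists Z : {set 'I_M}, [/\ Z \subset S0, w * K < #|Z|
    & {in Z &, forall i j, lt (g i) (g j) ->
        cmp (g i) \subset cmp (g j) \/ cmp (g j) \subset cmp (g i)}].
  have : #|S0| <= #|up| + #|S0 :\: up|.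
    by rewrite -(cardsID up S0) leq_add2r subset_leq_card // subsetIr.
  have [ltup _|leup] := ltnP (w * K) #|up|.
    exists up; split=> //; first by apply/subsetP=> j; rewrite inE => /andP[].
    move=> i j; rewrite !inE => /andP[_ /forall_inP iA] /andP[_ /forall_inP jA] ij.
    right; apply/subsetP=> a; rewrite !inE => /andP[aA]; rewrite aA /=.
    rewrite /inc !negb_and !negbK (negPf (iA _ aA)) (negPf (jA _ aA)) !orbF.
    by move=> /orP[/eqP<-|/(lt_trans ij)->]; rewrite ?ij orbT.
  move=> cS0; exists (S0 :\: up); split; first exact: subsetDl.
    by lia.
  move=> i j; rewrite !inE => /andP[+ iS] /andP[+ jS] ij; rewrite iS jS /= => inA jnA.
  have [_ _ _ [iA|iA]] := gP _ iS.
    by case/negP: inA; apply/forall_inP.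
  have [_ _ _ [jA|jA]] := gP _ jS.
    by case/negP: jnA; apply/forall_inP.
  left; apply/subsetP=> a; rewrite !inE => /andP[aA]; rewrite aA /=.
  rewrite /inc !negb_and !negbK (negPf (iA _ aA)) (negPf (jA _ aA)).
  by move=> /orP[/eqP<-|/= /lt_trans->]; rewrite ?ij ?orbT.
have ZS := subsetP sZS.
have [[s [s_sorted size_s sZ]]|[Y [sYZ ltY Yanti]]] :=
    chain_or_antichain (fun i j : 'I_M => lt (g i) (g j)) ltZ; last first.
  have g_inj : {in Y &, injective g}.
    move=> k j /(subsetP sYZ)/ZS kS /(subsetP sYZ)/ZS jS E.
    have [_ ck _ _] := gP _ kS; have [_ cj _ _] := gP _ jS.
    by rewrite -ck -cj E.
  suff : #|g @: Y| <= w by rewrite (card_in_imset g_inj) leqNgt ltY.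
  apply: wQ.
    by apply/subsetP=> z /imsetP[i /(subsetP sYZ)/ZS/gP[? _ _ _] ->].
  by move=> z z' /imsetP[k kY ->] /imsetP[j jY ->]; apply: Yanti.
have tr : transitive (fun i j : 'I_M => lt (g i) (g j)).
  by move=> y x z; apply: lt_trans.
have irr : irreflexive (fun i j : 'I_M => lt (g i) (g j)).
  by move=> x; apply: lt_irr.
pose X := [set x in s].
have cX : #|X| = K.+1.
  have /card_uniqP cs : uniq s by apply: sorted_uniq tr irr _ s_sorted.
  by rewrite cardsE cs size_s.
have XZ j : j \in X -> j \in Z by rewrite inE => /sZ.
have /card_gt0P[x1 x1X] : 0 < #|X| by rewrite cX.
have [j0 j0X0 j0max] := @arg_maxnP _ x1 [in X] (fun j => #|cmp (g j)|) x1X.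
have j0X : j0 \in X := j0X0.
have cmp_sub j : j \in X -> cmp (g j) \subset cmp (g j0).
  move=> jX; have jj0 : [|| j == j0, lt (g j) (g j0) | lt (g j0) (g j)].
    have js : j \in s by move: jX; rewrite inE.
    have j0s : j0 \in s by move: j0X; rewrite inE.
    case: (ltngtP (index j s) (index j0 s)) => idx.
    - by rewrite (sorted_ltn_index tr s_sorted _ _ js j0s idx) orbT.
    - by rewrite (sorted_ltn_index tr s_sorted _ _ j0s js idx) !orbT.
    - by rewrite -(nth_index j js) idx nth_index // eqxx.
  have : cmp (g j) \subset cmp (g j0) \/ cmp (g j0) \subset cmp (g j).
    case/or3P: jj0 => [/eqP->|/nested|/nested]; first by left.
      by apply; apply: XZ.
    by move/(_ (XZ _ j0X) (XZ _ jX))=> []; [right|left].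
  case=> // sub; have /eqP-> // : cmp (g j0) == cmp (g j).
  by rewrite eqEcard sub; apply: j0max.
pose A' := A :\: cmp (g j0).
have sA'A : A' \subset A := subsetDl _ _.
have cA' : uphalf #|A| <= #|A'|.
  have [_ _ le2 _] := gP _ (ZS _ (XZ _ j0X)).
  rewrite /A' cardsDS; last by apply/subsetP=> a; rewrite inE => /andP[].
  by move: le2; lia.
suff : #|X| <= K by rewrite cX ltnn.
apply: (grundy_restrict lt_irr lt_trans w_gt0 m_gt0 wQ noL (subset_trans sA'A sAQ)).
- apply: grundyS gQ; apply/subsetP=> j /XZ/ZS jS; by rewrite inE jS.
- move=> j jX; have [gQj cgj _ _] := gP _ (ZS _ (XZ _ jX)).
  apply/set0Pn; exists (g j); rewrite inE gQj cgj eqxx /=; apply/forall_inP=> a.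
  rewrite !inE => /andP[+ aA]; rewrite aA /= negbK => ncmp.
  apply/negPn/negP=> nj; have /(subsetP (cmp_sub _ jX)) : a \in cmp (g j).
    by rewrite inE aA.
  by rewrite inE aA ncmp.
move=> Q' S' sQ'Q incQ' gQ'; apply: IH gQ' => // B sBQ' antiB.
have disj : B :&: A' = set0.
  apply/setP=> x; rewrite inE in_set0; apply/negP=> /andP[/(subsetP sBQ') xQ' xA'].
  by have := incQ' _ _ xQ' xA'; rewrite /inc eqxx.
(* An antichain of [Q'] stays one when [A'] is added: this is how the width drops. *)
suff : #|B :|: A'| <= w by rewrite cardsU disj cards0; lia.
apply: wQ.
  by rewrite subUset (subset_trans sBQ') // (subset_trans sA'A).
move=> x y /setUP[xB|xA'] /setUP[yB|yA'].
- exact: antiB.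
- by have /and3P[] := incQ' _ _ (subsetP sBQ' _ xB) yA'.
- by have /and3P[] := incQ' _ _ (subsetP sBQ' _ yB) xA'.
- by apply: antiA; apply: (subsetP sA'A).
Qed.

End Step.

(** * The recursion in logarithmic coordinates *)

Section RealBound.
Local Open Scope ring_scope.
Variable R : realType.

(** The quadratic coefficient is chosen so that lowering [y] by [ln 2] gains about [5 * y], the cost
    of the factor [w ^ 5] of one halving. *)
Definition ff_exponent (b y : R) : R := 5 / (2 * ln 2) * y ^+ 2 + b * y.

(* With [y = ln w] and [y1 = ln w1]: either passing from [w] to [w1] gains a
   factor 2, or [w1] is so close to [w] that [w - w1 / 2] is almost [w / 2]. *)
Lemma ff_exponent_rec (b mu y y1 : R) : 0 <= mu ->
    b = (9 / 2 * ln 2 + ln 5 + 2 * mu) / ln 2 -> 0 <= y1 <= y ->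
  (y1 < y /\ ln 2 + ff_exponent b y1 <= ff_exponent b y) \/
  (forall y', 0 <= y' <= y + (y - y1) - ln 2 ->
     ln 5 + 5 * y + 2 * mu + ff_exponent b y' <= ff_exponent b y).
Proof.
move=> mu_ge0 bE /andP[y1_ge0 le_y1].
have L_gt0 : 0 < ln 2 :> R by rewrite ln_gt0 // ltr1n.
have ln5_ge0 : 0 <= ln 5 :> R by rewrite ln_ge0 // ler1n.
rewrite /ff_exponent; set L := ln 2 in L_gt0 bE *; set l5 := ln 5 in ln5_ge0 bE *.
set a := 5 / (2 * L).
have aL : a * L = 5 / 2 by rewrite /a; field; rewrite gt_eqF.
have bL : b * L = 9 / 2 * L + l5 + 2 * mu by rewrite bE; field; rewrite gt_eqF.
have a_gt0 : 0 < a by rewrite divr_gt0 // mulr_gt0.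
have b_ge1 : 1 <= b by rewrite -(ler_pM2r L_gt0) bL; nra.
pose eta := y - y1.
have eta_ge0 : 0 <= eta by rewrite subr_ge0.
(* [(a * y + b) * eta] bounds from below the gain in passing from [y] to [y1]. If it is less than
   [L], the loss [2 * a * y * eta + b * eta] in the second case is at most [2 * L]; with the
   [5 / 2 * L] coming from the square this makes the [9 / 2 * L] in [b * L]. *)
have [big|small] := lerP L ((a * y + b) * eta).
  left; split.
    rewrite -subr_gt0 -/eta lt_neqAle eta_ge0 andbT; apply/eqP=> eta0.
    by move: big; rewrite -eta0 mulr0 leNgt L_gt0.
  have -> : y1 = y - eta by rewrite /eta; ring.
  apply: (le_trans (lerD big (lexx _))).
  have := mulr_ge0 (ltW a_gt0) (mulr_ge0 eta_ge0 y1_ge0).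
  rewrite (_ : y1 = y - eta); last by rewrite /eta; ring.
  by nra.
right=> y' /andP[y'_ge0 le_y'].
have y_ge0 : 0 <= y by apply: le_trans le_y1.
pose y2 := y + eta - L.
have le2 : a * y' ^+ 2 + b * y' <= a * y2 ^+ 2 + b * y2.
  apply: lerD; last by rewrite ler_wpM2l // (le_trans ler01).
  by apply: (ler_wpM2l (ltW a_gt0)); rewrite ler_sqr ?nnegrE // (le_trans y'_ge0).
apply: le_trans (lerD (lexx _) le2) _.
have ayeta : 0 <= a * y * eta by rewrite mulr_ge0 // mulr_ge0 // ltW.
have eta_lt : eta < L by nra.
have sq : (L - eta) ^+ 2 <= L ^+ 2 by rewrite ler_sqr ?nnegrE; lra.
have asq : a * (L - eta) ^+ 2 <= 5 / 2 * L.
  by apply: le_trans (ler_wpM2l (ltW a_gt0) sq) _; rewrite expr2 mulrA aL.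
have -> : a * y2 ^+ 2 + b * y2 = a * y ^+ 2 - 2 * (a * L) * y + 2 * (a * y * eta)
   + a * (L - eta) ^+ 2 + b * y + b * eta - b * L by rewrite /y2; ring.
rewrite aL bL; nra.
Qed.


(** As a power of [w], the exponent is [5/2 lg w + 9/2 + lg 5 + 2 lg m]. *)
Definition ff_bound (m w : nat) : R :=
  expR (ff_exponent ((9 / 2 * ln 2 + ln 5 + 2 * ln m%:R) / ln 2) (ln w%:R)).

Lemma ff_bound_ge1 m w : (0 < m)%N -> (0 < w)%N -> 1 <= ff_bound m w.
Proof.
move=> m_gt0 w_gt0; rewrite -expR0 ler_expR /ff_exponent.
have L_gt0 : 0 < ln 2 :> R by rewrite ln_gt0 // ltr1n.
have ln_nat_ge0 n : (0 < n)%N -> 0 <= ln n%:R :> R by move=> ?; rewrite ln_ge0 // ler1n.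
apply: addr_ge0; first by rewrite mulr_ge0 ?exprn_ge0 ?divr_ge0 ?mulr_ge0 ?ln_nat_ge0 // ltW.
apply: mulr_ge0; last exact: ln_nat_ge0.
apply: divr_ge0; last exact: ltW.
have := ln_nat_ge0 _ m_gt0; have := ln_nat_ge0 5 isT; lra.
Qed.

Lemma ff_bound_rec (m w w1 : nat) : (0 < m)%N -> (0 < w1)%N -> (w1 <= w)%N -> (1 < w)%N ->
  ((w1 < w)%N /\ 2 * ff_bound m w1 <= ff_bound m w) \/
  5 * w%:R ^+ 5 * m%:R ^+ 2 * ff_bound m (w - uphalf w1) <= ff_bound m w.
Proof.
move=> m_gt0 w1_gt0 le_w1 w_gt1.
have w_gt0 : (0 < w)%N := ltnW w_gt1.
have pos n : (0 < n)%N -> (n%:R : R) \in Num.pos by move=> n_gt0; rewrite posrE ltr0n.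
have mu_ge0 : 0 <= ln m%:R :> R by rewrite ln_ge0 // ler1n.
have [|[ltw1 lew1]|small] := @ff_exponent_rec _ _ (ln w%:R) (ln w1%:R) mu_ge0 erefl.
- by rewrite ln_ge0 ?ler1n //= ler_ln ?pos // ler_nat.
- left; split; first by move: ltw1; rewrite ltr_ln ?pos // ltr_nat.
  by rewrite /ff_bound -{1}[2](@lnK R) ?posrE // -expRD ler_expR.
right.
set w' := (w - _)%N.
have w'_gt0 : (0 < w')%N by rewrite /w'; lia.
have bnd1 : 0 <= ln w'%:R :> R by rewrite ln_ge0 // ler1n.
(* From [2 w' <= 2 w - w1] and [(2 w - w1) w1 <= w^2]. *)
have bnd2 : ln w'%:R <= ln w%:R + (ln w%:R - ln w1%:R) - ln 2 :> R.
  rewrite lerBrDr addrA lerBrDr -!lnM ?pos ?muln_gt0 //; last first.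
  - by rewrite -natrM pos // muln_gt0 w'_gt0.
  rewrite -!natrM ler_ln ?pos ?muln_gt0 ?w'_gt0 ?w_gt0 // ler_nat /w'.
  have : (2 * (w - uphalf w1) <= 2 * w - w1)%N by lia.
  by nia.
have le_e := small _ (introT andP (conj bnd1 bnd2)).
rewrite -ler_expR in le_e; apply: le_trans le_e.
rewrite /ff_bound; move: (ff_exponent _ (ln w'%:R)) => e.
rewrite !expRD lnK ?posrE ?ltr0n //.
have -> : 5 * ln w%:R = ln (w%:R ^+ 5) :> R by rewrite lnXn ?ltr0n // mulr_natl.
have -> : 2 * ln m%:R = ln (m%:R ^+ 2) :> R by rewrite lnXn ?ltr0n // mulr_natl.
rewrite !lnK ?posrE ?exprn_gt0 ?ltr0n //.
Qed.

End RealBound.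

(** * The First-Fit bound *)

Section FirstFit.
Local Open Scope ring_scope.
Variables (R : realType) (T : finType) (M : nat) (col : T -> 'I_M) (lt : rel T).
Hypotheses (lt_irr : irreflexive lt) (lt_trans : transitive lt).

Lemma split_colours (S : {set 'I_M}) (h : nat) : (h <= #|S|)%N ->
  exists S0 S1 : {set 'I_M}, [/\ S = S0 :|: S1, #|S0| = h, #|S1| = (#|S| - h)%N
    & {in S0 & S1, forall i j : 'I_M, (i < j)%N}].
Proof.
elim: h => [|h IHh] le_h.
  exists set0, S; split; rewrite ?set0U ?cards0 ?subn0 //.
  by move=> i j; rewrite inE.
have [S0 [S1 [SE cS0 cS1 lt01]]] := IHh (ltnW le_h).
have /card_gt0P[k kS1] : (0 < #|S1|)%N by rewrite cS1; lia.
have [k0 k0S1' k0min] := @arg_minnP _ k [in S1] (fun j : 'I_M => val j) kS1.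
have k0S1 : k0 \in S1 := k0S1'.
have k0S0 : k0 \notin S0.
  by apply/negP=> k0S0; have := lt01 _ _ k0S0 k0S1; rewrite ltnn.
exists (k0 |: S0), (S1 :\ k0); split.
- rewrite SE; apply/setP=> i; rewrite !inE.
  by case: (eqVneq i k0) => [->|] //=; rewrite k0S1 orbT.
- by rewrite cardsU1 k0S0 cS0.
- by have := cardsD1 k0 S1; rewrite k0S1 cS1; lia.
move=> i j /setU1P[->|iS0]; rewrite !inE => /andP[jk0 jS1]; last exact: lt01.
by have := k0min _ jS1; rewrite leq_eqVlt eq_sym (inj_eq val_inj) (negPf jk0).
Qed.

(** The two cases of [ff_bound_rec] decide which half of the colours is estimated: the upper one
    directly by induction, when its width [#|A|] is small enough to afford doubling, otherwise the
    lower one through [grundy_step]. *)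
Theorem first_fit_bound (w m : nat) (Q : {set T}) (S : {set 'I_M}) :
    (0 < w)%N -> (0 < m)%N -> width_le lt Q w -> ~ ladder lt m -> grundy col lt Q S ->
  #|S|%:R <= ff_bound R m w.
Proof.
move=> w_gt0 m_gt0 + noL; elim/ltn_ind: w w_gt0 Q S => w IHw w_gt0 Q S wQ gQ.
have [g1 g2 g3] := gQ.
have [w_le1 | w_gt1] := leqP w 1.
  apply: le_trans (ff_bound_ge1 R m_gt0 w_gt0); rewrite lern1 leqNgt; apply/negP=> S_gt1.
  have [S0 [S1 [SE cS0 cS1 lt01]]] := split_colours (ltnW S_gt1).
  have /card_gt0P[i iS0] : (0 < #|S0|)%N by rewrite cS0.
  have /card_gt0P[j jS1] : (0 < #|S1|)%N by rewrite cS1 subn_gt0.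
  have iS : i \in S by rewrite SE inE iS0.
  have jS : j \in S by rewrite SE inE jS1 orbT.
  have [u uQ cu] := g1 _ jS.
  have [|z zQ [_ /and3P[uz n1 n2]]] := g3 _ uQ _ iS; first by rewrite cu; apply: lt01.
  have : (#|[set u; z]| <= w)%N.
    apply: wQ; first by rewrite subUset !sub1set uQ.
    by move=> x y; rewrite !inE => /orP[]/eqP-> /orP[]/eqP->; rewrite ?lt_irr.
  by rewrite cards2 uz ltnNge w_le1.
have [S0|S_gt0] := posnP #|S|.
  by rewrite S0 mulr0n expR_ge0.
have le_half : (#|S|./2 <= #|S|)%N by lia.
have [S0 [S1 [SE cS0 cS1 lt01]]] := split_colours le_half.
pose Q1 := [set u in Q | col u \in S1].
have Q1P u : reflect (u \in Q /\ col u \in S1) (u \in Q1) by rewrite inE; apply: andP.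
have sQ1Q : Q1 \subset Q by apply/subsetP=> u /Q1P[].
have S1S k : k \in S1 -> k \in S by rewrite SE inE orbC => ->.
have gQ1 : grundy col lt Q1 S1.
  split=> [j jS1|u v /Q1P[uQ _] /Q1P[vQ _]|u /Q1P[uQ _] k kS1 ku].
  - by have [u uQ cu] := g1 _ (S1S _ jS1); exists u => //; apply/Q1P; rewrite cu.
  - exact: g2.
  - have [z zQ [cz uz]] := g3 _ uQ _ (S1S _ kS1) ku.
    by exists z => //; apply/Q1P; rewrite cz.
pose anti (A : {set T}) := (A \subset Q1) && [forall x in A, forall y in A, ~~ lt x y].
have antiP (A : {set T}) : reflect (A \subset Q1 /\ {in A &, forall x y, ~~ lt x y}) (anti A).
  apply: (iffP andP) => -[sA aA]; split=> //.
    by move=> x y xA yA; move/forall_inP/(_ x xA)/forall_inP/(_ y yA): aA.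
  by apply/forall_inP=> x xA; apply/forall_inP=> y yA; apply: aA.
have anti0 : anti set0 by apply/antiP; split; [apply: sub0set | move=> x y; rewrite inE].
have [A /antiP[sAQ1 antiA] A_max] := arg_maxnP (fun A : {set T} => #|A|) anti0.
have wQ1 : width_le lt Q1 #|A|.
  by move=> B sB antiB; apply: A_max; apply/antiP.
have sAQ := subset_trans sAQ1 sQ1Q.
have le_Aw : (#|A| <= w)%N by apply: wQ.
have A_gt0 : (0 < #|A|)%N.
  have /card_gt0P[j jS1] : (0 < #|S1|)%N by rewrite cS1; lia.
  have [_ _ _] := gQ1; have [u uQ cu] := g1 _ (S1S _ jS1).
  rewrite -(cards1 u); apply: wQ1; first by rewrite sub1set; apply/Q1P; rewrite cu.
  by move=> x y; rewrite !inE => /eqP-> /eqP->; rewrite lt_irr.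
have [[ltAw]|] := ff_bound_rec R m_gt0 A_gt0 le_Aw w_gt1.
  apply: le_trans; have := IHw _ ltAw A_gt0 _ _ wQ1 gQ1.
  rewrite -(ler_pM2l (ltr0n R 2)); apply: le_trans.
  by rewrite -natrM ler_nat cS1; lia.
apply: le_trans.
set w' := (w - uphalf #|A|)%N.
have w'_gt0 : (0 < w')%N by rewrite /w'; lia.
have w'_lt : (w' < w)%N by rewrite /w'; lia.
pose f := Num.truncn (ff_bound R m w').
have bnd_ge0 : 0 <= ff_bound R m w' by apply: expR_ge0.
have f_gt0 : (0 < f)%N by rewrite truncn_gt0 ff_bound_ge1.
have f_le : f%:R <= ff_bound R m w' by rewrite truncn_le.
have : (#|S0| <= w * (w * (w * f * (w * m)) * (w * m)) * 2)%N.
  rewrite SE in gQ; apply: (grundy_step lt_irr lt_trans w_gt0 m_gt0 wQ noL gQ lt01 sAQ _ antiA).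
    by move=> a /(subsetP sAQ1)/Q1P[].
  by move=> Q' S' _ wQ' gQ'; rewrite truncn_ge_nat //; apply: IHw wQ' gQ'.
have -> : (w * (w * (w * f * (w * m)) * (w * m)) * 2 = 2 * (w ^ 5 * m ^ 2 * f))%N by ring.
move=> le_S0.
have K_gt0 : (0 < w ^ 5 * m ^ 2 * f)%N by rewrite !muln_gt0 ?expn_gt0 ?w_gt0 ?m_gt0 ?f_gt0.
(* With [K = w ^ 5 * m ^ 2 * f], the lower half, rounded down, has at most [2 K] colours. Hence
   [#|S| <= 4 K + 1 <= 5 K], which is the origin of the constant 5. *)
have le_S : (#|S| <= 5 * (w ^ 5 * m ^ 2 * f))%N.
  by move: le_S0 K_gt0; rewrite cS0; move: (w ^ 5 * _ * _)%N => K; lia.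
apply: le_trans (_ : (5 * (w ^ 5 * m ^ 2 * f))%:R <= _); first by rewrite ler_nat.
have -> : (5 * (w ^ 5 * m ^ 2 * f))%:R = 5 * w%:R ^+ 5 * m%:R ^+ 2 * f%:R :> R by ring.
by rewrite ler_wpM2l // !mulr_ge0.
Qed.

End FirstFit.

(** * Ladders in a regular poset *)

Section Regular.
(** [L] stands for the vertices of one level, named by their time of arrival, and [le] for the order
    of their antichains; [j <= h] in the factorization hypotheses thus says that [j] is the oldest.
    [e i j c d] relates the member labelled [c] of antichain [i] to the member labelled [d] of
    antichain [j]. *)
Variables (k : nat) (L : nat -> Prop) (le : nat -> nat -> Prop)
  (e : nat -> nat -> 'I_k -> 'I_k -> Prop).
Hypotheses
  (le_refl : forall i, L i -> le i i)
  (le_total : forall i j, L i -> L j -> le i j \/ le j i)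
  (le_trans : forall i j l, L i -> L j -> L l -> le i j -> le j l -> le i l)
  (e_le : forall i j c d, L i -> L j -> e i j c d -> le i j)
  (e_id : forall i j c, L i -> L j -> le i j -> e i j c c)
  (e_trans : forall i j l c d f, L i -> L j -> L l ->
     e i j c d -> e j l d f -> e i l c f)
  (e_match : forall i j c d, L i -> L j -> e i j c d ->
     exists pi : 'I_k -> 'I_k, [/\ injective pi, pi c = d & forall x, e i j x (pi x)])
  (e_factor_up : forall i j l c d, L i -> L j -> L l -> e i l c d -> le i j -> le j l ->
     (forall h, L h -> le j h -> le h l -> j <= h) ->
     exists f, e i j c f /\ e j l f d)
  (e_factor_dn : forall i j l c d, L i -> L j -> L l -> e i l c d -> le i j -> le j l ->
     (forall h, L h -> le i h -> le h j -> j <= h) ->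
     exists f, e i j c f /\ e j l f d).

Section Ladder.
Variables (m : nat) (x y : nat -> nat) (lx ly : nat -> 'I_k).
Hypotheses
  (Lx : forall i, i < m -> L (x i)) (Ly : forall i, i < m -> L (y i))
  (exx : forall i j, i < j -> j < m -> e (x i) (x j) (lx i) (lx j))
  (eyy : forall i j, i < j -> j < m -> e (y i) (y j) (ly i) (ly j))
  (exy : forall i, i < m -> e (x i) (y i) (lx i) (ly i))
  (no_up : forall i j, i < j -> j < m -> ~ e (x j) (y i) (lx j) (ly i))
  (no_dn : forall i j, i < m -> j < m -> ~ e (y i) (x j) (ly i) (lx j)).

Let le_xx i j : i <= j -> j < m -> le (x i) (x j).
Proof.
rewrite leq_eqVlt => /orP[/eqP-> /Lx/le_refl //|ij jm].
by apply: (e_le _ _ (exx ij jm)); apply: Lx; lia.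
Qed.

Let le_yy i j : i <= j -> j < m -> le (y i) (y j).
Proof.
rewrite leq_eqVlt => /orP[/eqP-> /Ly/le_refl //|ij jm].
by apply: (e_le _ _ (eyy ij jm)); apply: Ly; lia.
Qed.

(* Otherwise every [2 * k]-th rung starts above the previous one, and along
   such a rung the up-set of the first [y] gains a label. *)
Lemma crossing_rungs : 2 * k * k < m ->
  exists i, i + 2 * k < m /\ ~ le (y i) (x (i + 2 * k)).
Proof.
move=> ltm; apply: contrapT => no.
have k_gt0 : 0 < k by case: (lx 0) => i; lia.
have cross i : i + 2 * k < m -> le (y i) (x (i + 2 * k)).
  by move=> im; apply: contrapT => nle; apply: no; exists i.
have m_gt0 : 0 < m by lia.
pose U l : {set 'I_k} := [set c | `[< e (y 0) l (ly 0) c >]].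
have grow t : t <= k -> t < #|U (y (2 * k * t))|.
  elim: t => [|t IHt] le_t.
    rewrite muln0; apply/card_gt0P; exists (ly 0); rewrite inE; apply/asboolP.
    by apply: e_id; [exact: Ly | exact: Ly | apply: le_refl; exact: Ly].
  apply: leq_ltn_trans (IHt (ltnW le_t)) _.
  set i := 2 * k * t; set j := 2 * k * t.+1.
  have jE : j = i + 2 * k by rewrite /i /j mulnS addnC.
  have jm : j < m by apply: leq_ltn_trans ltm; rewrite /j leq_mul2l le_t orbT.
  have im : i < m by lia.
  have [Lxj Lyj] := (Lx jm, Ly jm); have [Lyi Ly0] := (Ly im, Ly m_gt0).
  (* The matching through the rung sends [U (x j)] injectively into [U (y j)], and with it the label
     [lx j], which [no_dn] keeps out of [U (x j)]: one label is gained. *)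
  have [pi [pi_inj pi_j pi_e]] := e_match Lxj Lyj (exy jm).
  have sU : U (y i) \subset U (x j).
    apply/subsetP=> c; rewrite !inE => /asboolP ec; apply/asboolP.
    by apply: (e_trans Ly0 Lyi Lxj ec); apply: e_id => //; rewrite jE; apply: cross; lia.
  have nxj : lx j \notin U (x j).
    by rewrite inE; apply/asboolP/no_dn.
  apply: leq_ltn_trans (subset_leq_card sU) _.
  have <- : #|pi @: (lx j |: U (x j))| = #|U (x j)|.+1.
    by rewrite card_imset // cardsU1 nxj.
  apply: subset_leq_card; apply/subsetP=> d /imsetP[c /setU1P[->|cU] ->].
    by rewrite inE pi_j; apply/asboolP/eyy => //; lia.
  rewrite inE in cU; move/asboolP: cU => cU; rewrite inE; apply/asboolP.
  exact: e_trans cU (pi_e c).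
by have := grow k (leqnn _); rewrite ltnNge (leq_trans (max_card _)) ?card_ord.
Qed.

(* Rungs [i .. i + 2 * k] cross. The oldest level [h0] met by the middle one
   lies above all the [x] or below all the [y] involved, so the rungs of one
   half all factor through [h0], at distinct labels. *)
Lemma regular_ladder : m <= 2 * k * k.
Proof.
rewrite leqNgt; apply/negP=> ltm.
have [i [im ncross]] := crossing_rungs ltm.
have Lyi : L (y i) by apply: Ly; lia.
have Lxi : L (x (i + 2 * k)) by apply: Lx; lia.
have le_xy : le (x (i + 2 * k)) (y i) by have [] := le_total Lyi Lxi.
pose c := i + k.
have cm : c < m by rewrite /c; lia.
pose between h := `[< L h /\ le (x c) h /\ le h (y c) >].
have [|h0 /asboolP[Lh0 [xh0 h0y]] h0_min] := @ex_minnP between.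
  exists (x c); apply/asboolP; split; first exact: Lx.
  by split; [apply: le_xx | apply: e_le (exy cm); [exact: Lx | exact: Ly]].
(* Two of [k + 1] rungs meeting [h0] in the same label would give a path from the later [x] to the
   earlier [y], against [no_up]. *)
have pigeon (f : nat -> 'I_k) : (forall a b, a < b -> b <= k -> f a <> f b) -> False.
  move=> f_neq; have f_inj : injective (fun a : 'I_k.+1 => f a).
    move=> a b fab; apply: val_inj; case: (ltngtP (val a) (val b)) => // ab.
      by case: (f_neq _ _ ab (ltnSE (ltn_ord b)) fab).
    by case: (f_neq _ _ ab (ltnSE (ltn_ord a)) (esym fab)).
  by have := leq_card _ f_inj; rewrite !card_ord ltnn.
have [h0yi|yih0] := le_total Lh0 Lyi.
  have /choice[f fP] : forall a, exists f, a <= k ->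
      e (x (i + a)) h0 (lx (i + a)) f /\ e h0 (y (i + a)) f (ly (i + a)).
    move=> a; have [le_a|_] := leqP a k; last by exists (lx 0).
    have am : i + a < m by lia.
    have [Lxa Lya] := (Lx am, Ly am).
    have [|||f fP] := e_factor_up Lxa Lh0 Lya (exy am).
    - by apply: le_trans xh0 => //; [exact: Lx | apply: le_xx => //; rewrite /c; lia].
    - by apply: le_trans h0yi _ => //; apply: le_yy => //; lia.
    - move=> h Lh h0h hya; apply: h0_min; apply/asboolP; split=> //; split.
        by apply: le_trans xh0 h0h => //; exact: Lx.
      apply: le_trans hya _ => //; first exact: Ly.
      by apply: le_yy => //; rewrite /c; lia.
    - by exists f.
  apply: (pigeon f) => a b ab le_b fab.
  have [_ fa] := fP a (ltnW (leq_trans ab le_b)).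
  have [fb _] := fP b le_b; rewrite -fab in fb.
  have am : i + a < m by lia.
  have bm : i + b < m by lia.
  apply: (@no_up (i + a) (i + b)) => //; first by rewrite ltn_add2l.
  exact: (e_trans (Lx bm) Lh0 (Ly am) fb fa).
have xh0' : le (x (i + 2 * k)) h0 by apply: le_trans le_xy yih0.
have /choice[f fP] : forall a, exists f, a <= k ->
    e (x (c + a)) h0 (lx (c + a)) f /\ e h0 (y (c + a)) f (ly (c + a)).
  move=> a; have [le_a|_] := leqP a k; last by exists (lx 0).
  have am : c + a < m by rewrite /c; lia.
  have [Lxa Lya] := (Lx am, Ly am).
  have [|||f fP] := e_factor_dn Lxa Lh0 Lya (exy am).
  - by apply: le_trans xh0' => //; apply: le_xx => //; rewrite /c; lia.
  - apply: le_trans h0y _ => //; first exact: Ly.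
    by apply: le_yy => //; lia.
  - move=> h Lh xah hh0; apply: h0_min; apply/asboolP; split=> //; split.
      apply: le_trans xah => //; first exact: Lx.
      by apply: le_xx => //; lia.
    by apply: le_trans hh0 h0y => //; exact: Ly.
  - by exists f.
apply: (pigeon f) => a b ab le_b fab.
have [_ fa] := fP a (ltnW (leq_trans ab le_b)).
have [fb _] := fP b le_b; rewrite -fab in fb.
have am : c + a < m by rewrite /c; lia.
have bm : c + b < m by rewrite /c; lia.
apply: (@no_up (c + a) (c + b)) => //; first by rewrite ltn_add2l.
exact: (e_trans (Lx bm) Lh0 (Ly am) fb fa).
Qed.

End Ladder.
End Regular.

(** * Choices determined by their predicate *)

Section Epsilon.
Variable (T : choiceType) (x0 : T) (P : T -> Prop).

(** The choice depends on nothing but the predicate and the default, so equal histories lead to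
    equal choices. *)
Definition pick_by : T :=
  if pselect (exists x, `[< P x >]) is left exP then xchoose exP else x0.

Lemma pick_byP x : P x -> P pick_by.
Proof.
move=> Px; rewrite /pick_by; case: pselect => [exP|[]]; last by exists x; apply/asboolP.
exact/asboolP/(xchooseP exP).
Qed.

Lemma pick_by_or : P pick_by \/ pick_by = x0.
Proof.
rewrite /pick_by; case: pselect => [exP|_]; last by right.
left; exact/asboolP/(xchooseP exP).
Qed.

End Epsilon.

Definition least (P : nat -> Prop) : nat :=
  pick_by 0 (fun n => P n /\ forall m, P m -> n <= m).

Lemma leastP (P : nat -> Prop) n : P n -> P (least P) /\ forall m, P m -> least P <= m.
Proof.
move=> Pn; have exP : exists n, `[< P n >] by exists n; apply/asboolP.
have [k /asboolP Pk k_min] := ex_minnP exP.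
apply: (@pick_byP _ 0 (fun n => P n /\ forall m, P m -> n <= m) k).
by split=> // m Pm; apply/k_min/asboolP.
Qed.

(** * Course-of-values recursion on an on-line relation *)

Definition agree n (r r' : rel nat) := forall i j, i <= n -> j <= n -> r i j = r' i j.

Definition trunc n (r : rel nat) : rel nat := fun i j => [&& i <= n, j <= n & r i j].

Lemma agree_trunc n r r' : agree n r r' -> trunc n r = trunc n r'.
Proof.
move=> rr'; apply/funext=> i; apply/funext=> j; rewrite /trunc.
by case: leqP => //= ?; case: leqP => //= ?; apply: rr'.
Qed.

Lemma agreeS n r r' i : i <= n -> agree n r r' -> agree i r r'.
Proof. by move=> le_i rr' a b ? ?; apply: rr'; lia. Qed.

Lemma trunc_agree n r i : i <= n -> agree i (trunc n r) r.
Proof. by move=> le_i a b ? ?; rewrite /trunc !(leq_trans _ le_i). Qed.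

Section CourseOfValues.
Variables (X : Type) (x0 : X) (F : rel nat -> (nat -> X) -> nat -> X).

(** [F] is handed only the truncated relation and the values before [n], so the result is on-line
    for every [F], whatever quantifiers [F] contains. *)
Fixpoint history (r : rel nat) (n : nat) : seq X :=
  if n is n'.+1 then
    rcons (history r n') (F (trunc n' r) (nth x0 (history r n')) n')
  else [::].

Definition cov (r : rel nat) (n : nat) : X := nth x0 (history r n.+1) n.

Lemma size_history r n : size (history r n) = n.
Proof. by elim: n => //= n IHn; rewrite size_rcons IHn. Qed.

Lemma nth_history r n i : nth x0 (history r n) i = if i < n then cov r i else x0.
Proof.
elim: n => [|n IHn]; first by rewrite nth_nil.
case: (ltngtP i n) => [lt_i|gt_i|->]; last by rewrite ltnSn.
  by rewrite ltnS (ltnW lt_i) /= nth_rcons size_history lt_i IHn lt_i.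
by rewrite ltnS leqNgt gt_i /= nth_default // size_rcons size_history.
Qed.

Lemma covE r n : cov r n = F (trunc n r) (fun i => if i < n then cov r i else x0) n.
Proof.
rewrite /cov /= nth_rcons size_history ltnn eqxx.
by congr F; apply/funext=> i; rewrite nth_history.
Qed.

Lemma cov_online n r r' : agree n r r' -> cov r n = cov r' n.
Proof.
elim/ltn_ind: n => n IHn rr'; rewrite !covE (agree_trunc rr').
congr F; apply/funext=> i; case: ifP => // lt_i.
by apply: IHn => //; apply: agreeS (ltnW lt_i) rr'.
Qed.

End CourseOfValues.

(** * The levels and their antichains *)

Definition antic (r : rel nat) (S : seq nat) : Prop :=
  {in S &, forall x y, r x y -> x = y}.

Definition width_bound (r : rel nat) (P : pred nat) (k : nat) : Prop :=
  forall S : seq nat, uniq S -> all P S -> antic r S -> size S <= k.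

Definition sub (r : rel nat) (A B : seq nat) : bool := all (fun x => has (r x) B) A.

(** Asking for all [j] from [k] on keeps each union of levels up to [j] at width at most [j]; the
    failure at [k - 1] supplies an antichain of size [k] through the new vertex. *)
Definition level_step (r : rel nat) (f : nat -> nat) (n : nat) : nat :=
  least (fun k => forall j, k <= j ->
    width_bound r (fun i => (i == n) || (i < n) && (f i <= j)) j).

Definition lev : rel nat -> nat -> nat := cov 0 level_step.

Definition anti_spec (r : rel nat) (n : nat) (B : nat -> seq nat) (S : seq nat) : Prop :=
  [/\ uniq S, size S = lev r n, n \in S /\ antic r S,
      all (fun i => (i <= n) && (lev r i <= lev r n)) S
    & forall i, i < n -> lev r i = lev r n -> sub r (B i) S \/ sub r S (B i)].

Definition anti : rel nat -> nat -> seq nat :=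
  cov [::] (fun r B n => pick_by [::] (anti_spec r n B)).

Lemma anti_online n r r' : agree n r r' -> anti r n = anti r' n.
Proof. exact: cov_online. Qed.

Lemma lev_online n r r' : agree n r r' -> lev r n = lev r' n.
Proof. exact: cov_online. Qed.

Lemma sub_agree n r r' A B : agree n r r' ->
  {in A, forall x, x <= n} -> {in B, forall x, x <= n} -> sub r A B = sub r' A B.
Proof.
move=> rr' An Bn; apply: eq_in_all => x xA; apply: eq_in_has => y yB.
by apply: rr'; [apply: An | apply: Bn].
Qed.

Lemma anti_le r n : {in anti r n, forall i, i <= n}.
Proof.
rewrite /anti covE; set P := anti_spec _ _ _.
case: (pick_by_or [::] P) => [[_ _ _ /allP H _]|->] i //.
by case/H/andP.
Qed.

Lemma antic_agree n r r' S : agree n r r' -> {in S, forall x, x <= n} ->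
  antic r S -> antic r' S.
Proof. by move=> rr' Sn aS x y xS yS; rewrite -rr' ?Sn //; apply: aS. Qed.

Lemma anti_specE r n (B : nat -> seq nat) S : (forall i, i < n -> B i = anti r i) ->
  anti_spec (trunc n r) n B S <-> anti_spec r n (anti r) S.
Proof.
move=> BE; have levE i : i <= n -> lev (trunc n r) i = lev r i.
  by move=> le_i; apply/lev_online/trunc_agree.
have ag := trunc_agree r (leqnn n).
have ag' : agree n r (trunc n r) by move=> i j ? ?; rewrite ag.
split=> -[uS sS [nS aS] lS cS].
  have Sn : {in S, forall i, i <= n} by move=> i /(allP lS)/andP[].
  split=> //; first by rewrite sS levE.
  - by split=> //; apply: antic_agree ag Sn aS.
  - by apply/allP=> i /(allP lS)/andP[le_i]; rewrite !levE // le_i.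
  - move=> i lt_i li; have := cS i lt_i.
    rewrite levE; last exact: ltnW.
    rewrite levE; last exact: leqnn.
    move=> /(_ li).
    have An : {in anti r i, forall x, x <= n}.
      by move=> x /anti_le le_x; apply: leq_trans le_x (ltnW lt_i).
    rewrite BE //.
    rewrite (sub_agree ag An Sn).
    by rewrite (sub_agree ag Sn An).
have Sn : {in S, forall i, i <= n} by move=> i /(allP lS)/andP[].
split=> //; first by rewrite sS levE.
- by split=> //; apply: antic_agree ag' Sn aS.
- by apply/allP=> i /(allP lS)/andP[le_i]; rewrite !levE // le_i.
- move=> i lt_i; rewrite levE; last exact: ltnW.
  rewrite levE; last exact: leqnn.
  move=> li; have An : {in anti r i, forall x, x <= n}.
    by move=> x /anti_le le_x; apply: leq_trans le_x (ltnW lt_i).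
  have := cS i lt_i li; rewrite BE // -(sub_agree ag An Sn).
  by rewrite -(sub_agree ag Sn An).
Qed.

Lemma antiP r n S : anti_spec r n (anti r) S -> anti_spec r n (anti r) (anti r n).
Proof.
have BE i : i < n -> (if i < n then anti r i else [::]) = anti r i by move->.
move/(anti_specE _ BE)/(pick_byP [::])/(anti_specE _ BE).
by rewrite [in anti r n]/anti covE.
Qed.

Lemma levP r n :
  (forall j, lev r n <= j ->
     width_bound r (fun i => (i == n) || (i < n) && (lev r i <= j)) j) /\
  (forall k, (forall j, k <= j ->
     width_bound r (fun i => (i == n) || (i < n) && (lev r i <= j)) j) -> lev r n <= k).
Proof.
pose P (r : rel nat) f k := forall j, k <= j ->
  width_bound r (fun i => (i == n) || (i < n) && (f i <= j)) j.
have PE k : P (trunc n r) (fun i => if i < n then lev r i else 0) k <-> P r (lev r) k.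
  have predE j : (fun i => (i == n) || (i < n) && ((if i < n then lev r i else 0) <= j)) =
      (fun i => (i == n) || (i < n) && (lev r i <= j)).
    by apply/funext=> i; case: ltnP.
  have Sn j S : all (fun i => (i == n) || (i < n) && (lev r i <= j)) S ->
      {in S, forall i, i <= n}.
    by move=> /allP allS i /allS /orP[/eqP->//|/andP[/ltnW]].
  have ag := trunc_agree r (leqnn n).
  have ag' : agree n r (trunc n r) by move=> i j ? ?; rewrite ag.
  split=> H j le_j S uS allS aS.
    by apply: (H j le_j) => //; [rewrite predE | apply: antic_agree ag' (Sn _ _ allS) aS].
  rewrite predE in allS; apply: (H j le_j) => //.
  exact: antic_agree ag (Sn _ _ allS) aS.
(* [n.+1] always qualifies, since only [n.+1] vertices are present. *)
have [|Plev lev_min] := @leastP (P (trunc n r) (fun i => if i < n then lev r i else 0)) n.+1.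
  move=> j lt_j S uS allS aS; apply: leq_trans lt_j.
  rewrite -[n.+1](size_iota 0) uniq_leq_size // => i /(allP allS).
  by rewrite mem_iota /= => /orP[/eqP->//|/andP[/ltnW]].
have lE : lev r n = least (P (trunc n r) (fun i => if i < n then lev r i else 0)).
  by rewrite {1}/lev covE.
split=> [|k /PE/lev_min]; last by rewrite lE.
by have /PE := Plev; rewrite -lE.
Qed.

(** * The regular suborder *)

(** On duplicate-free lists of equal length, as are the antichains of one level, [f] is a perfect
    matching upwards from [A] to [B]. *)
Definition core (r : rel nat) (A B : seq nat) (x y : nat) : Prop :=
  exists f : nat -> nat, [/\ x \in A, f x = y,
    {in A, forall a, f a \in B /\ r a (f a)} & {in A &, injective f}].

Definition succ_level (r : rel nat) (s v : nat) : Prop :=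
  [/\ s < v, lev r s = lev r v, sub r (anti r v) (anti r s)
    & forall i, i < v -> lev r i = lev r v -> sub r (anti r v) (anti r i) ->
        sub r (anti r s) (anti r i)].

Definition pred_level (r : rel nat) (p v : nat) : Prop :=
  [/\ p < v, lev r p = lev r v, sub r (anti r p) (anti r v)
    & forall i, i < v -> lev r i = lev r v -> sub r (anti r i) (anti r v) ->
        sub r (anti r i) (anti r p)].

(* [flow r i j x y]: the copy of [x] in [anti r i] lies below the copy of [y]
   in [anti r j] in the regular poset. *)
Inductive flow (r : rel nat) : nat -> nat -> nat -> nat -> Prop :=
| flow_refl i x : x \in anti r i -> flow r i i x x
| flow_up v s j x z y : succ_level r s v -> j < v ->
    core r (anti r v) (anti r s) x z -> flow r s j z y -> flow r v j x y
| flow_dn i p v x z y : pred_level r p v -> i < v ->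
    flow r i p x z -> core r (anti r p) (anti r v) z y -> flow r i v x y.

Definition reg_lt (r : rel nat) : rel nat := fun i j => (i != j) && `[< flow r i j i j >].

(** First-Fit on the regular suborder, each level by itself. *)
Definition col_step (r : rel nat) (f : nat -> nat) (n : nat) : nat :=
  least (fun c => forall i, i < n -> lev r i = lev r n -> f i = c ->
    reg_lt r i n || reg_lt r n i).

Definition col : rel nat -> nat -> nat := cov 0 col_step.

Section Online.
Variables (n : nat) (r r' : rel nat).
Hypothesis rr' : agree n r r'.

Let levE i : i <= n -> lev r i = lev r' i.
Proof. by move=> le_i; apply/lev_online/(agreeS le_i). Qed.

Let antiE i : i <= n -> anti r i = anti r' i.
Proof. by move=> le_i; apply/anti_online/(agreeS le_i). Qed.

Let anti_n i : i <= n -> {in anti r i, forall x, x <= n}.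
Proof. by move=> le_i x /anti_le le_x; apply: leq_trans le_x le_i. Qed.

Let subE i j : i <= n -> j <= n ->
  sub r (anti r i) (anti r j) = sub r' (anti r' i) (anti r' j).
Proof.
move=> le_i le_j; rewrite -(antiE le_i) -(antiE le_j).
by apply: (sub_agree rr'); apply: anti_n.
Qed.

Let coreE i j x y : i <= n -> j <= n ->
  core r (anti r i) (anti r j) x y -> core r' (anti r' i) (anti r' j) x y.
Proof.
move=> le_i le_j; rewrite -(antiE le_i) -(antiE le_j) => -[f [xA fx fA f_inj]].
exists f; split=> // a aA; have [fB rf] := fA a aA; split=> //.
by rewrite -rr' //; [apply: (anti_n le_i) | apply: (anti_n le_j)].
Qed.

(** Each rule replaces the younger end by an older neighbour, so a flow never leaves the history. *)
Lemma flow_online i j x y : i <= n -> j <= n -> flow r i j x y -> flow r' i j x y.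
Proof.
move=> + + Fxy; elim: Fxy => {i j x y} [i x xA le_i _|v s j x z y|i p v x z y].
- by apply: flow_refl; rewrite -antiE.
- move=> [lt_s ls sub_s s_min] lt_j cxz _ IH le_v le_j.
  have le_s : s <= n by lia.
  apply: (@flow_up _ v s j x z y) => //; [split=> // | exact: coreE | exact: IH].
  + by rewrite -!levE.
  + by rewrite -subE.
  + move=> i lt_i; have le_i : i <= n by lia.
    by rewrite -!levE // -!subE //; apply: s_min.
- move=> [lt_s ls sub_s s_min] lt_j _ IH cxz le_i le_v.
  have le_p : p <= n by lia.
  apply: (@flow_dn _ i p v x z y) => //; [split=> // | exact: IH | exact: coreE].
  + by rewrite -!levE.
  + by rewrite -subE.
  + move=> j lt_j'; have le_j : j <= n by lia.
    by rewrite -!levE // -!subE //; apply: s_min.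
Qed.

End Online.

Lemma agreeC n r r' : agree n r r' -> agree n r' r.
Proof. by move=> rr' i j le_i le_j; rewrite rr'. Qed.

Lemma reg_lt_online n r r' i j : agree n r r' -> i <= n -> j <= n ->
  reg_lt r i j = reg_lt r' i j.
Proof.
move=> rr' le_i le_j; congr (_ && _); apply/asbool_equiv_eq.
by split; [exact: (flow_online rr') | exact: (flow_online (agreeC rr'))].
Qed.

Lemma col_online n r r' : agree n r r' -> col r n = col r' n.
Proof. exact: cov_online. Qed.

Lemma colP r n :
  (forall i, i < n -> lev r i = lev r n -> col r i = col r n ->
     reg_lt r i n || reg_lt r n i) /\
  (forall c, c < col r n -> exists i, [/\ i < n, lev r i = lev r n, col r i = c
     & ~~ (reg_lt r i n || reg_lt r n i)]).
Proof.
pose P c := forall i, i < n -> lev r i = lev r n -> col r i = c ->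
    reg_lt r i n || reg_lt r n i.
have colE : col r n = least P.
  rewrite {1}/col covE; congr least; apply/funext=> c; apply/propext.
  have ag := trunc_agree r (leqnn n).
  have levE i : i <= n -> lev (trunc n r) i = lev r i.
    by move=> le_i; apply/lev_online/trunc_agree.
  split=> H i lt_i.
    have := H i lt_i; rewrite lt_i !levE ?(reg_lt_online ag) //; exact: ltnW.
  rewrite lt_i !levE ?(reg_lt_online ag) //; [exact: H | exact: ltnW ..].
have [|Pcol col_min] := @leastP P (\max_(i < n) col r i).+1.
  move=> i lt_i _ ci; have := leq_bigmax (F := fun j : 'I_n => col r j) (Ordinal lt_i).
  by rewrite /= ci ltnn.
rewrite colE; split=> // c lt_c; apply: contrapT => no.
suff /col_min : P c by rewrite leqNgt lt_c.
move=> i lt_i li ci; apply: contrapT => /negP ni; apply: no; exists i; split=> //.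
Qed.

Lemma core_sound r A B x y : core r A B x y -> r x y.
Proof. by case=> f [xA <- /(_ x xA)[]]. Qed.

Lemma flow_sound r i j x y : reflexive r -> transitive r -> flow r i j x y -> r x y.
Proof.
move=> rxx rtr; elim=> {i j x y} [i x _|v s j x z y _ _ /core_sound xz _|i p v x z y _ _ _ xz].
- exact: rxx.
- exact: rtr.
- by move/core_sound; apply: rtr.
Qed.

Lemma col_chain r x y : reflexive r -> transitive r ->
  lev r x = lev r y -> col r x = col r y -> r x y || r y x.
Proof.
move=> rxx rtr lxy cxy.
have sound a b : reg_lt r a b -> r a b.
  by case/andP=> _ /asboolP; apply: flow_sound.
case: (ltngtP x y) => [lt_xy|lt_yx|->]; last by rewrite rxx.
  by have [/(_ x lt_xy lxy cxy)/orP[]/sound-> _] := colP r y; rewrite ?orbT.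
by have [/(_ y lt_yx (esym lxy) (esym cxy))/orP[]/sound-> _] := colP r x; rewrite ?orbT.
Qed.

(** * The regular suborder is ladder-free *)

Section Analysis.
Variable r : rel nat.
Hypotheses (rxx : reflexive r) (ranti : antisymmetric r) (rtr : transitive r).

Lemma seq_max (S : seq nat) : S != [::] -> exists2 v, v \in S & {in S, forall i, i <= v}.
Proof.
elim: S => // x [|y S] IHS _.
  by exists x; rewrite ?mem_head // => i; rewrite inE => /eqP->.
have [v vS vmax] := IHS isT.
have [le_xv|lt_vx] := leqP x v.
  exists v; first by rewrite in_cons vS orbT.
  by move=> i; rewrite in_cons => /predU1P[->|/vmax].
exists x; rewrite ?mem_head // => i; rewrite in_cons => /predU1P[->//|/vmax le_i].
exact: leq_trans le_i (ltnW lt_vx).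
Qed.

Lemma width_lev j : width_bound r (fun i => lev r i <= j) j.
Proof.
move=> S uS /allP lS aS; have [->//|/seq_max[v vS vmax]] := eqVneq S [::].
have [wb _] := levP r v; apply: (wb j (lS v vS)) => //.
apply/allP=> i iS; rewrite (lS i iS) andbT -leq_eqVlt; exact: vmax.
Qed.

Lemma lev_gt0 n : 0 < lev r n.
Proof.
rewrite lt0n; apply/eqP=> l0; have [/(_ 0) + _] := levP r n; rewrite l0.
move=> /(_ isT [:: n]); rewrite /= eqxx => /(_ isT isT) H; suff : 1 <= 0 by [].
by apply: H => x y; rewrite !inE => /eqP-> /eqP->.
Qed.

(** A Dilworth cover, which belongs to the analysis only: the label of a vertex may depend on later
    ones. *)
Lemma labelling (N k : nat) : exists lab : nat -> 'I_k.+1,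
  forall i j, i < N -> j < N -> lev r i <= k.+1 -> lev r j <= k.+1 ->
    lab i = lab j -> r i j || r j i.
Proof.
pose le (i j : 'I_N) := r i j.
have [|||S [sS aS]|c [ltc cP]] := @dilworth _ le _ _ _ k.+1 [set i : 'I_N | lev r i <= k.+1].
- by move=> i; apply: rxx.
- by move=> i j /ranti/val_inj.
- by move=> i j l; apply: rtr.
- rewrite cardE -(size_map val); apply: width_lev.
  + by rewrite (map_inj_uniq val_inj) enum_uniq.
  + apply/allP=> x /mapP[i]; rewrite mem_enum => /(subsetP sS) + ->.
    by rewrite inE.
  + move=> x y /mapP[i + ->] /mapP[j + ->]; rewrite !mem_enum => iS jS ij.
    by rewrite (aS i j).
exists (fun i => if insub i is Some j then inord (c j) else ord0) => i j iN jN li lj.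
rewrite (insubT (fun i => i < N) iN) (insubT (fun i => i < N) jN) /=.
have iX : Ordinal iN \in [set i : 'I_N | lev r i <= k.+1] by rewrite inE.
have jX : Ordinal jN \in [set i : 'I_N | lev r i <= k.+1] by rewrite inE.
move=> /(congr1 val); rewrite /= !inordK ?ltc // => E.
by have := cP _ _ iX jX E.
Qed.

(** The lattice of maximum antichains, computed label by label; the reversed relation gives the
    meet. *)
Lemma pointwise_join (I : eqType) (q : rel nat) (a b : I -> nat) :
    reflexive q -> transitive q ->
    (forall c, q (a c) (b c) || q (b c) (a c)) ->
    (forall c d, q (a c) (a d) -> c = d) -> (forall c d, q (b c) (b d) -> c = d) ->
  exists b' : I -> nat, [/\ forall c, b' c = a c \/ b' c = b c,
    forall c, q (a c) (b' c), forall c, q (b c) (b' c)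
    & forall c d, q (b' c) (b' d) -> c = d].
Proof.
move=> qxx qtr qab qa qb; pose b' c := if q (b c) (a c) then a c else b c.
have ab' c : q (a c) (b' c) by rewrite /b'; case: ifP (qab c) => //; rewrite orbF.
have bb' c : q (b c) (b' c) by rewrite /b'; case: ifP.
exists b'; split=> // [c|c d qcd].
  by rewrite /b'; case: ifP; [left | right].
have [E|E] : b' d = a d \/ b' d = b d by rewrite /b'; case: ifP; [left | right].
  by apply: qa; rewrite -E; apply: qtr (ab' c) qcd.
by apply: qb; rewrite -E; apply: qtr (bb' c) qcd.
Qed.

(** * Maximum antichains, indexed by labels *)

Section Levels.
Variables (N k' : nat) (lab : nat -> 'I_k'.+1).
Let k := k'.+1.
Hypothesis labP : forall i j, i < N -> j < N -> lev r i <= k -> lev r j <= k ->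
    lab i = lab j -> r i j || r j i.

Definition max_antichain (S : seq nat) : Prop :=
  [/\ uniq S, size S = k, {in S, forall i, i < N /\ lev r i <= k} & antic r S].

Definition el (S : seq nat) (c : 'I_k) : nat := nth 0 S (find (fun x => lab x == c) S).

Lemma lab_inj S : max_antichain S -> {in S &, injective lab}.
Proof.
move=> [_ _ lS aS] x y xS yS E.
have [[xN lx] [yN ly]] := (lS x xS, lS y yS).
by have /orP[/aS->|/aS->] := labP xN yN lx ly E.
Qed.

Lemma elP S c : max_antichain S -> el S c \in S /\ lab (el S c) = c.
Proof.
move=> mS; have [uS sS _ _] := mS.
have hS : has (fun x => lab x == c) S.
  have Ul : uniq (map lab S) by rewrite map_inj_in_uniq // => x y; apply: lab_inj.
  have sub_enum : {subset map lab S <= enum 'I_k} by move=> x _; rewrite mem_enum.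
  have [|_ labS] := uniq_min_size Ul sub_enum.
    by rewrite (size_map lab) sS size_enum_ord.
  have : c \in map lab S by rewrite labS mem_enum.
  by case/mapP=> x xS ->; apply/hasP; exists x.
by split; [rewrite mem_nth // -has_find | apply/eqP; have := nth_find 0 hS].
Qed.

Lemma el_in S c : max_antichain S -> el S c \in S.
Proof. by case/(elP c). Qed.

Lemma lab_el S c : max_antichain S -> lab (el S c) = c.
Proof. by case/(elP c). Qed.

Lemma el_lab S x : max_antichain S -> x \in S -> el S (lab x) = x.
Proof. by move=> mS xS; apply: (lab_inj mS) => //; [apply: el_in | rewrite lab_el]. Qed.

Lemma el_comparable S S' c : max_antichain S -> max_antichain S' ->
  r (el S c) (el S' c) || r (el S' c) (el S c).
Proof.
move=> mS mS'; have [_ _ lS _] := mS; have [_ _ lS' _] := mS'.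
have [[? ?] [? ?]] := (lS _ (el_in c mS), lS' _ (el_in c mS')).
by apply: labP; rewrite ?lab_el.
Qed.

Lemma subP S S' : max_antichain S -> max_antichain S' ->
  sub r S S' <-> forall c, r (el S c) (el S' c).
Proof.
move=> mS mS'; split=> [/allP sSS' c|H].
  have /orP[//|le'] := el_comparable c mS mS'.
  have /hasP[y yS' xy] := sSS' _ (el_in c mS).
  have [_ _ _ aS'] := mS'.
  by rewrite (aS' _ y (el_in c mS') yS' (rtr le' xy)).
apply/allP=> x xS; apply/hasP; exists (el S' (lab x)); first exact: el_in.
by have := H (lab x); rewrite el_lab.
Qed.

Definition on_level i : Prop := i < N /\ lev r i = k.

Lemma seq_of_el (b : 'I_k -> nat) : (forall c, lab (b c) = c) ->
  (forall c, b c < N /\ lev r (b c) <= k) -> (forall c d, r (b c) (b d) -> c = d) ->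
  max_antichain [seq b c | c <- enum 'I_k] /\
  forall c, el [seq b c | c <- enum 'I_k] c = b c.
Proof.
move=> lb bN ab; have mS : max_antichain [seq b c | c <- enum 'I_k].
  split; first by rewrite map_inj_uniq ?enum_uniq // => c d E; rewrite -(lb c) E lb.
  - by rewrite size_map size_enum_ord.
  - by move=> i /mapP[c _ ->].
  - by move=> x y /mapP[c _ ->] /mapP[d _ ->] /ab->.
split=> // c; rewrite -{1}(lb c) el_lab //.
by apply/mapP; exists c; rewrite ?mem_enum.
Qed.

(** The specification of [anti r n] can be met: start from the antichain through [n] supplied by the
    minimality of its level, and for each earlier [t] of the level replace it by its join or meet
    with [anti r t]. The result is comparable to [anti r t], and, the earlier antichains being
    linearly ordered, it stays comparable to those already treated. *)
Lemma level_antichain n : on_level n -> [/\ max_antichain (anti r n), n \in anti r n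
  & forall i, i < n -> on_level i ->
      sub r (anti r i) (anti r n) \/ sub r (anti r n) (anti r i)].
Proof.
elim/ltn_ind: n => n IHn [nN ln].
have [wb lev_min] := levP r n.
have [S [uS allS aS ltS]] : exists S, [/\ uniq S,
    all (fun i => (i == n) || (i < n) && (lev r i <= k')) S, antic r S & k' < size S].
  apply: contrapT => no; suff /lev_min : forall j, k' <= j ->
      width_bound r (fun i => (i == n) || (i < n) && (lev r i <= j)) j by rewrite ln ltnn.
  move=> j; rewrite leq_eqVlt => /orP[/eqP<-|lt_j]; last by apply: wb; rewrite ln.
  by move=> S uS allS aS; rewrite leqNgt; apply/negP=> ltS; apply: no; exists S.
have SP i : i \in S -> i <= n /\ lev r i <= k.
  move=> /(allP allS)/orP[/eqP->|/andP[lt_i li]]; first by rewrite ln.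
  by rewrite ltnW // leqW.
have nS : n \in S.
  apply/negPn/negP=> nS; suff : size S <= k' by rewrite leqNgt ltS.
  apply: width_lev => //; apply/allP=> i iS.
  have /orP[/eqP E|/andP[]//] := allP allS i iS.
  by rewrite -E iS in nS.
have mS : max_antichain S.
  split=> //; last by move=> i /SP[le_i]; split=> //; apply: leq_ltn_trans nN.
  apply/eqP; rewrite eqn_leq ltS andbT; apply: width_lev => //.
  by apply/allP=> i /SP[].
have step t : t <= n -> exists b : 'I_k -> nat, [/\ forall c, lab (b c) = c,
    forall c, b c <= n /\ lev r (b c) <= k, forall c d, r (b c) (b d) -> c = d,
    b (lab n) = n
    & forall i, i < t -> on_level i ->
       (forall c, r (el (anti r i) c) (b c)) \/ (forall c, r (b c) (el (anti r i) c))].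
  elim: t => [_|t IHt lt_tn].
    exists (el S); split=> // [c|c|c d|]; rewrite ?lab_el ?el_lab //; first exact/SP/el_in.
    have [_ _ _ aS'] := mS.
    by move=> /aS'-/(_ (el_in _ mS) (el_in _ mS))/(congr1 lab); rewrite !lab_el.
  have [b [lb bn ab b_n b_t]] := IHt (ltnW lt_tn).
  have [Lt|nLt] := pselect (on_level t); last first.
    exists b; split=> // i; rewrite ltnS leq_eqVlt => /predU1P[->|] //; exact: b_t.
  have [mt tt t_cmp] := IHn t lt_tn Lt.
  pose a := el (anti r t).
  have an c : a c <= n /\ lev r (a c) <= k.
    have [_ _ /(_ _ (el_in c mt))[_ ?] _] := mt; split=> //.
    exact: leq_trans (anti_le (el_in c mt)) (ltnW lt_tn).
  have aa c d : r (a c) (a d) -> c = d.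
    have [_ _ _ at'] := mt.
    by move=> /at'-/(_ (el_in _ mt) (el_in _ mt))/(congr1 lab); rewrite !lab_el.
  have la c : lab (a c) = c by apply: lab_el.
  have a_cmp i : i < t -> on_level i ->
      (forall c, r (el (anti r i) c) (a c)) \/ (forall c, r (a c) (el (anti r i) c)).
    move=> lt_i Li; have [mi _ _] := IHn i (ltn_trans lt_i lt_tn) Li.
    by have [/subP H|/subP H] := t_cmp i lt_i Li; [left|right]; apply: H.
  have ab_cmp c : r (a c) (b c) || r (b c) (a c).
    have [[? ?] [? ?]] := (an c, bn c).
    by apply: labP; rewrite ?la ?lb //; apply: leq_ltn_trans nN.
  (* The position of [n] relative to the member of [anti r t] with its label tells which of join and
     meet keeps [n]. *)
  have /orP[an_n|n_an] : r (a (lab n)) n || r n (a (lab n)).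
    by have := ab_cmp (lab n); rewrite b_n.
  - have [b' [b'E ab' bb' b'b']] := pointwise_join rxx rtr ab_cmp aa ab.
    exists b'; split=> // [c|c||i]; [by case: (b'E c) => ->..| |].
      have := bb' (lab n); case: (b'E (lab n)) => ->; rewrite b_n // => n_an.
      by apply: ranti; rewrite an_n.
    rewrite ltnS leq_eqVlt => /predU1P[-> _|lt_i Li]; first by left=> c; apply: ab'.
    have [H|H] := b_t i lt_i Li; first by left=> c; apply: rtr (H c) (bb' c).
    have [H'|H'] := a_cmp i lt_i Li; first by left=> c; apply: rtr (H' c) (ab' c).
    by right=> c; case: (b'E c) => ->.
  - pose q x y := r y x.
    have qtr : transitive q by move=> y x z xy yz; apply: rtr yz xy.
    have ab_cmp' c : q (a c) (b c) || q (b c) (a c) by rewrite orbC ab_cmp.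
    have [||b' [b'E ab' bb' b'b']] := @pointwise_join _ q a b rxx qtr ab_cmp'.
    + by move=> c d /aa.
    + by move=> c d /ab.
    exists b'; split=> // [c|c|c d cd||i]; [by case: (b'E c) => ->..| | |].
    + by apply/esym/b'b'.
    + have := bb' (lab n); case: (b'E (lab n)) => ->; rewrite b_n // /q => an_n.
      by apply: ranti; rewrite an_n.
    rewrite ltnS leq_eqVlt => /predU1P[-> _|lt_i Li]; first by right=> c; apply: ab'.
    have [H|H] := b_t i lt_i Li; last by right=> c; apply: rtr (bb' c) (H c).
    have [H'|H'] := a_cmp i lt_i Li; last by right=> c; apply: rtr (ab' c) (H' c).
    by left=> c; case: (b'E c) => ->.
have [b [lb bn ab b_n b_cmp]] := step n (leqnn n).
have [|mB elB] := seq_of_el lb _ ab.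
  by move=> c; have [? ?] := bn c; split=> //; apply: leq_ltn_trans nN.
set B := [seq b c | c <- enum 'I_k] in mB elB.
have specB : anti_spec r n (anti r) B.
  have [uB sB _ aB] := mB; split=> //; first by rewrite ln.
  - by split=> //; apply/mapP; exists (lab n); rewrite ?mem_enum.
  - by apply/allP=> i /mapP[c _ ->]; rewrite ln; have [-> ->] := bn c.
  - move=> i lt_i; rewrite ln => li; have Li : on_level i by split=> //; apply: ltn_trans nN.
    have [mi _ _] := IHn i lt_i Li.
    have [H|H] := b_cmp i lt_i Li; [left|right]; apply/subP => // c; rewrite elB; exact: H.
have [uA sA [nA aA] lA cA] := antiP specB.
rewrite ln in sA lA cA; split=> //.
  split=> // i /(allP lA)/andP[le_i ->]; split=> //; exact: leq_ltn_trans nN.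
by move=> i lt_i [_ li]; apply: cA.
Qed.

End Levels.
End Analysis.

Lemma largest_of_three i j l : i != j -> j != l -> i != l ->
  (j < i /\ l < i) \/ ((i < l /\ j < l) \/ (i < j /\ l < j)).
Proof. lia. Qed.

Lemma least_before (P : nat -> Prop) (q : nat -> nat -> Prop) n :
    (forall i j, P i -> P j -> q i j \/ q j i) ->
    (forall i j l, P i -> P j -> P l -> q i j -> q j l -> q i l) ->
    (exists2 h, h < n & P h) ->
  exists s, [/\ s < n, P s & forall h, h < n -> P h -> q s h].
Proof.
move=> q_total q_trans; elim: n => [[]//|n IHn [h lt_h Ph]].
have [/IHn[s [lt_s Ps s_min]]|nex] := pselect (exists2 h, h < n & P h); last first.
  have hn : h = n.
    apply/eqP; move: lt_h; rewrite ltnS leq_eqVlt => /orP[//|lt_h].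
    by case: nex; exists h.
  rewrite hn in Ph; exists n; split=> // g.
  rewrite ltnS leq_eqVlt => /orP[/eqP-> Pn|lt_g Pg]; first by case: (q_total n n).
  by case: nex; exists g.
have [Pn|nPn] := pselect (P n); last first.
  exists s; split=> [||g]; [exact: ltnW | by [] |].
  by rewrite ltnS leq_eqVlt => /orP[/eqP->|]; [|exact: s_min].
have [sn|ns] := q_total s n Ps Pn.
  exists s; split=> [||g]; [exact: ltnW | by [] |].
  by rewrite ltnS leq_eqVlt => /orP[/eqP->|]; [|exact: s_min].
exists n; split=> // g; rewrite ltnS leq_eqVlt => /orP[/eqP-> _|lt_g Pg].
  by case: (q_total n n).
exact: q_trans Pn Ps Pg ns (s_min _ lt_g Pg).
Qed.

(** * Transitivity, matchings and factorization of flows *)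

Section Flow.
Variable r : rel nat.
Hypotheses (rxx : reflexive r) (ranti : antisymmetric r) (rtr : transitive r).
Variables (N k' : nat) (lab : nat -> 'I_k'.+1).
Let k := k'.+1.
Hypothesis labP : forall i j, i < N -> j < N -> lev r i <= k -> lev r j <= k ->
    lab i = lab j -> r i j || r j i.

Let L := on_level r N k'.
Let A := anti r.
Let le i j : Prop := sub r (A i) (A j).
Let lA := level_antichain rxx ranti rtr labP.

Let mA i : L i -> max_antichain r N k' (A i).
Proof. by case/lA. Qed.

Let A_self i : L i -> i \in A i.
Proof. by case/lA. Qed.

Let lt_L i s : L i -> s < i -> lev r s = lev r i -> L s.
Proof. by move=> [iN li] lt_s ls; split; [apply: ltn_trans iN | rewrite ls]. Qed.

Let lev_L i j : L i -> L j -> lev r i = lev r j.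
Proof. by move=> [_ ->] [_ ->]. Qed.

Let leP i j : L i -> L j -> le i j <-> forall c, r (el lab (A i) c) (el lab (A j) c).
Proof. by move=> Li Lj; apply: subP; auto. Qed.

Lemma level_refl i : L i -> le i i.
Proof. by move=> Li; apply/leP. Qed.

Lemma level_trans i j l : L i -> L j -> L l -> le i j -> le j l -> le i l.
Proof.
move=> Li Lj Ll /(leP Li Lj) ij /(leP Lj Ll) jl; apply/leP => // c.
exact: rtr (ij c) (jl c).
Qed.

Lemma level_total i j : L i -> L j -> le i j \/ le j i.
Proof.
move=> Li Lj; case: (ltngtP i j) => [ij|ji|->]; last by left; apply: level_refl.
  by have [_ _ /(_ i ij Li)] := lA Lj.
by have [_ _ /(_ j ji Lj)[]] := lA Li; [right | left].
Qed.

(** Each vertex is the youngest member of its own antichain, so the antichain determines it. *)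
Lemma level_anti i j : L i -> L j -> le i j -> le j i -> i = j.
Proof.
move=> Li Lj /(leP Li Lj) ij /(leP Lj Li) ji.
have elE c : el lab (A i) c = el lab (A j) c by apply: ranti; rewrite ij ji.
have mem a b : L a -> L b -> (forall c, el lab (A a) c = el lab (A b) c) -> a <= b.
  move=> La Lb E; apply: anti_le; rewrite -(el_lab labP (mA La) (A_self La)) E.
  exact: (el_in labP _ (mA Lb)).
by apply/eqP; rewrite eqn_leq !mem.
Qed.

Lemma flow_mem i j x y : flow r i j x y -> x \in A i /\ y \in A j.
Proof.
by elim=> {i j x y} [i x xA|v s j x z y _ _ [f [xA _ _ _]] _ []|i p v x z y _ _ _ [] xA _
  [f [zA <- /(_ _ zA)[] ? _]]].
Qed.

Lemma flow_le i j x y : flow r i j x y -> L i -> L j -> le i j.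
Proof.
elim=> {i j x y} [i x _ Li _|v s j x z y [lt_s ls vs _] lt_j _ _ IH Lv Lj
   |i p v x z y [lt_p lp pv _] lt_i _ IH _ Li Lv].
- exact: level_refl.
- by have Ls := lt_L Lv lt_s ls; apply: level_trans vs (IH Ls Lj).
- by have Lp := lt_L Lv lt_p lp; apply: level_trans (IH Li Lp) pv.
Qed.

Lemma flow_eq i x y : flow r i i x y -> x = y.
Proof.
move E: {2}i => j F; case: F E => // [v s l x' z y' _ lt_l _ _ E|l p v x' z y' _ lt_l _ _ E].
  by rewrite E ltnn in lt_l.
by rewrite E ltnn in lt_l.
Qed.

Lemma flow_upE i j x y : j < i -> flow r i j x y ->
  exists s z, [/\ succ_level r s i, core r (A i) (A s) x z & flow r s j z y].
Proof.
move=> + F; case: F => [l x' _|v s l x' z y' vs _ c F _|l p v x' z y' _ lt_l _ _].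
- by rewrite ltnn.
- by exists s, z.
- by move/(ltn_trans lt_l); rewrite ltnn.
Qed.

Lemma flow_dnE i j x y : i < j -> flow r i j x y ->
  exists p z, [/\ pred_level r p j, flow r i p x z & core r (A p) (A j) z y].
Proof.
move=> + F; case: F => [l x' _|v s l x' z y' _ lt_l _ _|l p v x' z y' vs _ F c _].
- by rewrite ltnn.
- by move/(ltn_trans lt_l); rewrite ltnn.
- by exists p, z.
Qed.

Lemma core_comp (B1 B2 B3 : seq nat) x y z :
  core r B1 B2 x y -> core r B2 B3 y z -> core r B1 B3 x z.
Proof.
move=> [f [xB fx fB f_inj]] [g [yB gy gB g_inj]]; exists (g \o f); split=> //=.
- by rewrite fx.
- move=> a /fB[fa rfa]; have [ga rga] := gB _ fa; split=> //; exact: rtr rfa rga.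
- by move=> a b aB bB /g_inj/f_inj->//; have [] := fB _ aB; have [] := fB _ bB.
Qed.

Lemma core_id i j c : L i -> L j -> le i j ->
  core r (A i) (A j) (el lab (A i) c) (el lab (A j) c).
Proof.
move=> Li Lj /(leP Li Lj) ij; have [mi mj] := (mA Li, mA Lj).
exists (fun x => el lab (A j) (lab x)); split.
- exact: (el_in labP _ mi).
- by rewrite (lab_el labP _ mi).
- move=> a aA; split; first exact: (el_in labP _ mj).
  by rewrite -{1}(el_lab labP mi aA).
- move=> a b aA bA /(congr1 lab); rewrite !(lab_el labP _ mj).
  exact: (lab_inj labP mi).
Qed.

Lemma exists_succ_level v j : L v -> j < v -> L j -> le v j -> exists s, succ_level r s v.
Proof.
move=> Lv lt_j Lj vj.
have [|||s [lt_s [Ls vs] s_min]] := @least_before (fun h => L h /\ le v h) le v.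
- by move=> h i [Lh _] [Li _]; apply: level_total.
- by move=> h i l [Lh _] [Li _] [Ll _]; apply: level_trans.
- by exists j.
exists s; split=> //; first exact: lev_L.
by move=> i lt_i li vi; apply: s_min => //; split=> //; apply: lt_L li.
Qed.

Lemma exists_pred_level v j : L v -> j < v -> L j -> le j v -> exists p, pred_level r p v.
Proof.
move=> Lv lt_j Lj jv.
have [|||p [lt_p [Lp pv] p_max]] :=
    @least_before (fun h => L h /\ le h v) (fun h i => le i h) v.
- by move=> h i [Lh _] [Li _]; apply: level_total.
- by move=> h i l [Lh _] [Li _] [Ll _] ih li; apply: level_trans li ih.
- by exists j.
exists p; split=> //; first exact: lev_L.
by move=> i lt_i li iv; apply: p_max => //; split=> //; apply: lt_L li.
Qed.

(** Equal labels always form a perfect matching and so are never dropped: each label remains a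
    chain, and the regular suborder has width at most [k]. *)
Lemma flow_id i j c : L i -> L j -> le i j -> flow r i j (el lab (A i) c) (el lab (A j) c).
Proof.
have [n] := ubnP (maxn i j); elim: n i j => // n IHn i j lt_n Li Lj ij.
case: (ltngtP i j) => [lt_ij|lt_ji|eq_ij].
- have [p predp] := exists_pred_level Lj lt_ij Li ij.
  have [lt_p lp pj p_max] := predp; have Lp := lt_L Lj lt_p lp.
  apply: (flow_dn predp lt_ij _ (core_id c Lp Lj pj)); apply: IHn => //; first by lia.
  exact: p_max (lev_L Li Lj) ij.
- have [s succs] := exists_succ_level Li lt_ji Lj ij.
  have [lt_s ls is_ s_min] := succs; have Ls := lt_L Li lt_s ls.
  apply: (flow_up succs lt_ji (core_id c Li Ls is_)); apply: IHn => //; first by lia.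
  exact: s_min (lev_L Lj Li) ij.
- by rewrite -eq_ij; apply: flow_refl; apply: (el_in labP _ (mA Li)).
Qed.

Lemma flow_match i j x y : flow r i j x y -> exists f : nat -> nat,
  [/\ f x = y, {in A i, forall a, flow r i j a (f a)} & {in A i &, injective f}].
Proof.
elim=> {i j x y} [i x xA|v s j x z y vs lt_j cxz _ [g [gz gF g_inj]]
   |i p v x z y vs lt_i _ [f [fx fF f_inj]] czy].
- by exists id; split=> // a aA; apply: flow_refl.
- have [f [xA fx fA f_inj]] := cxz; exists (g \o f); split=> /=; first by rewrite fx.
    move=> a aA; have [fa rfa] := fA a aA; apply: flow_up vs lt_j _ (gF _ fa).
    by exists f; split.
  move=> a b aA bA /g_inj E; apply: f_inj => //; apply: E.
    by have [] := fA _ aA.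
  by have [] := fA _ bA.
- have [g [zA gz gA g_inj]] := czy; exists (g \o f); split=> /=; first by rewrite fx.
    move=> a aA; have [_ fa] := flow_mem (fF a aA).
    by apply: flow_dn vs lt_i (fF a aA) _; exists g; split.
  move=> a b aA bA /g_inj E; apply: f_inj => //; apply: E.
    by have [_] := flow_mem (fF a aA).
  by have [_] := flow_mem (fF b bA).
Qed.

(* If [p] and [s] were consecutive when [j] was inserted between them, then
   the later of the two was inserted next to the earlier one. *)
Lemma flow_consecutive p s j x y : L j -> pred_level r p j -> succ_level r s j ->
  core r (A p) (A s) x y -> flow r p s x y.
Proof.
move=> Lj [lt_p lp pj p_max] [lt_s ls js s_min] cxy.
have [Lp Ls] := (lt_L Lj lt_p lp, lt_L Lj lt_s ls).
have ps : le p s := level_trans Lp Lj Ls pj js.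
have yA : y \in A s by have [f [xA <- /(_ x xA)[]]] := cxy.
have xA : x \in A p by have [f []] := cxy.
case: (ltngtP p s) => [lt_ps|lt_sp|E].
- apply: (flow_dn _ lt_ps (flow_refl xA) cxy).
  split; [by [] | by rewrite lp ls | by [] | move=> i lt_i li is_].
  have Li : L i := lt_L Ls lt_i li.
  have lt_ij : i < j := ltn_trans lt_i lt_s.
  have [ij|ji] := level_total Li Lj; first exact: p_max (lev_L Li Lj) ij.
  have si : le s i := s_min i lt_ij (lev_L Li Lj) ji.
  by have E := level_anti Li Ls is_ si; rewrite E ltnn in lt_i.
- apply: (flow_up _ lt_sp cxy (flow_refl yA)).
  split; [by [] | by rewrite lp ls | by [] | move=> i lt_i li pi].
  have Li : L i := lt_L Lp lt_i li.
  have lt_ij : i < j := ltn_trans lt_i lt_p.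
  have [ij|ji] := level_total Li Lj; last exact: s_min (lev_L Li Lj) ji.
  have ip : le i p := p_max i lt_ij (lev_L Li Lj) ij.
  by have E := level_anti Li Lp ip pi; rewrite E ltnn in lt_i.
- rewrite -E in js; have Ejp := level_anti Lj Lp js pj.
  by rewrite Ejp ltnn in lt_p.
Qed.

(** Induction on the youngest of the three indices, which is replaced by a neighbour. The critical
    case is a youngest middle index [j]: both flows pass next to it, through its neighbours [p] and
    [s], and the composed matching from [p] to [s] is a flow by [flow_consecutive]. *)
Lemma flow_trans i j l x y z : L i -> L j -> L l ->
  flow r i j x y -> flow r j l y z -> flow r i l x z.
Proof.
have [n] := ubnP (maxn i (maxn j l)).
elim: n i j l x y z => // n IHn i j l x y z lt_n Li Lj Ll Fij Fjl.
have [eq_ij|ne_ij] := eqVneq i j.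
  by rewrite -eq_ij in Fij Fjl; rewrite (flow_eq Fij).
have [eq_jl|ne_jl] := eqVneq j l.
  by rewrite -eq_jl in Fjl *; rewrite -(flow_eq Fjl).
have [ij jl] := (flow_le Fij Li Lj, flow_le Fjl Lj Ll).
have [eq_il|ne_il] := eqVneq i l.
  by rewrite -eq_il in jl; rewrite (level_anti Li Lj ij jl) eqxx in ne_ij.
have [[lt_ji lt_li]|[[lt_il lt_jl]|[lt_ij lt_lj]]] :
    (j < i /\ l < i) \/ ((i < l /\ j < l) \/ (i < j /\ l < j)).
  exact: largest_of_three.
- have [s [a [succs cxa Fsj]]] := flow_upE lt_ji Fij.
  have [lt_s ls _ _] := succs; have Ls := lt_L Li lt_s ls.
  apply: (flow_up succs lt_li cxa); apply: IHn Fsj Fjl => //; lia.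
- have [p [a [predp Fjp caz]]] := flow_dnE lt_jl Fjl.
  have [lt_p lp _ _] := predp; have Lp := lt_L Ll lt_p lp.
  apply: (flow_dn predp lt_il _ caz); apply: IHn Fij Fjp => //; lia.
- have [p [a [predp Fip cay]]] := flow_dnE lt_ij Fij.
  have [s [b [succs cyb Fsl]]] := flow_upE lt_lj Fjl.
  have Fps := flow_consecutive Lj predp succs (core_comp cay cyb).
  have [lt_p lp _ _] := predp; have Lp := lt_L Lj lt_p lp.
  have [lt_s ls _ _] := succs; have Ls := lt_L Lj lt_s ls.
  have Fis : flow r i s x b by apply: IHn Fip Fps => //; lia.
  by apply: IHn Fis Fsl => //; lia.
Qed.

(** Unwinding a flow moves its younger end to a neighbour, which cannot jump over [j], since [j] was
    already present. Being oldest is required only between [j] and [l]: for a rung that overlaps the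
    middle rung in part, no more is known. *)
Lemma flow_factor_up i j l x z : L i -> L j -> L l -> flow r i l x z ->
    le i j -> le j l -> (forall h, L h -> le j h -> le h l -> j <= h) ->
  exists y, flow r i j x y /\ flow r j l y z.
Proof.
have [n] := ubnP (maxn i l).
elim: n i l x z => // n IHn i l x z lt_n Li Lj Ll Fil ij jl old.
have [xA zA] := flow_mem Fil.
have [eq_jl|ne_jl] := eqVneq j l.
  by rewrite eq_jl in ij *; exists z; split=> //; apply: flow_refl.
have [eq_ij|ne_ij] := eqVneq i j.
  by rewrite -eq_ij; exists x; split=> //; apply: flow_refl.
have le_jl := old l Ll jl (level_refl Ll).
have lt_jl : j < l by rewrite ltn_neqAle ne_jl.
case: (ltngtP i l) => [lt_il|lt_li|eq_il].
- have [p [a [predp Fip caz]]] := flow_dnE lt_il Fil.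
  have [lt_p lp pl p_max] := predp; have Lp := lt_L Ll lt_p lp.
  have jp : le j p := p_max j lt_jl (lev_L Lj Ll) jl.
  have [||y [Fij Fjp]] := IHn i p x a _ Li Lj Lp Fip ij jp.
  + by lia.
  + by move=> h Lh jh hp; apply: old => //; apply: level_trans hp pl.
  exists y; split=> //; exact: flow_dn predp lt_jl Fjp caz.
- have [s [a [succs cxa Fsl]]] := flow_upE lt_li Fil.
  have [lt_s ls is_ s_min] := succs; have Ls := lt_L Li lt_s ls.
  have lt_ji := ltn_trans lt_jl lt_li.
  have sj : le s j := s_min j lt_ji (lev_L Lj Li) ij.
  have [||y [Fsj Fjl]] := IHn s l a z _ Ls Lj Ll Fsl sj jl; [lia|exact: old|].
  exists y; split=> //; exact: flow_up succs lt_ji cxa Fsj.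
- rewrite -eq_il in jl; have := level_anti Li Lj ij jl => E.
  by rewrite E eqxx in ne_ij.
Qed.

Lemma flow_factor_dn i j l x z : L i -> L j -> L l -> flow r i l x z ->
    le i j -> le j l -> (forall h, L h -> le i h -> le h j -> j <= h) ->
  exists y, flow r i j x y /\ flow r j l y z.
Proof.
have [n] := ubnP (maxn i l).
elim: n i l x z => // n IHn i l x z lt_n Li Lj Ll Fil ij jl old.
have [xA zA] := flow_mem Fil.
have [eq_jl|ne_jl] := eqVneq j l.
  by rewrite eq_jl in ij *; exists z; split=> //; apply: flow_refl.
have [eq_ij|ne_ij] := eqVneq i j.
  by rewrite -eq_ij; exists x; split=> //; apply: flow_refl.
have le_ji := old i Li (level_refl Li) ij.
have lt_ji : j < i by rewrite ltn_neqAle eq_sym ne_ij.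
case: (ltngtP i l) => [lt_il|lt_li|eq_il].
- have [p [a [predp Fip caz]]] := flow_dnE lt_il Fil.
  have [lt_p lp pl p_max] := predp; have Lp := lt_L Ll lt_p lp.
  have lt_jl := ltn_trans lt_ji lt_il.
  have jp : le j p := p_max j lt_jl (lev_L Lj Ll) jl.
  have [||y [Fij Fjp]] := IHn i p x a _ Li Lj Lp Fip ij jp; [lia|exact: old|].
  exists y; split=> //; exact: flow_dn predp lt_jl Fjp caz.
- have [s [a [succs cxa Fsl]]] := flow_upE lt_li Fil.
  have [lt_s ls is_ s_min] := succs; have Ls := lt_L Li lt_s ls.
  have sj : le s j := s_min j lt_ji (lev_L Lj Li) ij.
  have [||y [Fsj Fjl]] := IHn s l a z _ Ls Lj Ll Fsl sj jl.
  + by lia.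
  + by move=> h Lh sh hj; apply: old => //; apply: level_trans is_ sh.
  exists y; split=> //; exact: flow_up succs lt_ji cxa Fsj.
- rewrite -eq_il in jl; have := level_anti Li Lj ij jl => E.
  by rewrite E eqxx in ne_ij.
Qed.

End Flow.

(** * First-Fit on one level *)

Section ColourBound.
Variables (R : realType) (r : rel nat).
Hypotheses (rxx : reflexive r) (ranti : antisymmetric r) (rtr : transitive r).

(** [first_fit_bound] is applied to the vertices of the level of [n] presented up to [n] with colour
    at most that of [n]; by [colP] all [(col r n).+1] colours occur among them. *)
Lemma col_bound n : ((col r n).+1%:R <= ff_bound R (2 * lev r n * lev r n).+1 (lev r n))%R.
Proof.
have := lev_gt0 r n; set k := lev r n; case E: k => [//|k'] _.
pose N := n.+1.
have [lab labP] := labelling rxx ranti rtr N k'.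
pose L := on_level r N k'.
have LE i : i < N -> lev r i = k'.+1 -> L i by [].
have lvA := level_antichain rxx ranti rtr labP.
have elE i : L i -> el lab (anti r i) (lab i) = i.
  by move=> Li; have [mi ii _] := lvA i Li; apply: (el_lab labP mi ii).
pose lt : rel 'I_N := fun i j => [&& lev r i == k'.+1, lev r j == k'.+1 & reg_lt r i j].
have ltIP (i j : 'I_N) : reflect [/\ L i, L j, i != j & flow r i j i j] (lt i j).
  apply: (iffP and3P) => [[/eqP li /eqP lj /andP[ij /asboolP F]]|[[_ li] [_ lj] ij F]].
    by split=> //; apply: LE.
  by rewrite li lj; split=> //; apply/andP; split=> //; apply/asboolP.
have lt_irr : irreflexive lt by move=> i; apply/negP=> /ltIP[_ _]; rewrite eqxx.
have flow_tr := @flow_trans r rxx ranti rtr N k' lab labP.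
have lt_trans : transitive lt.
  move=> j i l /ltIP[Li Lj ij Fij] /ltIP[_ Ll jl Fjl]; apply/ltIP; split=> //.
    apply/eqP=> eq_il; rewrite -eq_il in Fjl Ll.
    have ij' := flow_le rxx ranti rtr labP Fij Li Lj.
    have ji' := flow_le rxx ranti rtr labP Fjl Lj Li.
    have := level_anti rxx ranti rtr labP Li Lj ij' ji' => /val_inj eij.
    by rewrite eij eqxx in ij.
  exact: flow_tr Fij Fjl.
pose Q := [set i : 'I_N | (lev r i == k'.+1) && (col r i <= col r n)].
have wQ : width_le lt Q k'.+1.
  move=> S /subsetP sSQ aS; rewrite -[k'.+1]card_ord.
  apply: (@leq_card_in _ _ (fun i : 'I_N => lab i)).
  move=> i j iS jS lij; apply/eqP/negPn/negP=> ij.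
  have LQ x : x \in S -> L x.
    by move/sSQ; rewrite inE => /andP[/eqP lx _]; apply: LE.
  have [Li Lj] := (LQ i iS, LQ j jS).
  have [ij'|ji'] := level_total rxx ranti rtr labP Li Lj.
    have := flow_id rxx ranti rtr labP (lab i) Li Lj ij'; rewrite elE // lij elE // => F.
    by have /negP[] := aS i j iS jS; apply/ltIP.
  have := flow_id rxx ranti rtr labP (lab i) Lj Li ji'; rewrite elE // lij elE // => F.
  by have /negP[] := aS j i jS iS; apply/ltIP; rewrite eq_sym.
have noL : ~ ladder lt (2 * k'.+1 * k'.+1).+1.
  move=> [u [z [uz_mono rung no_up no_dn]]]; set m := _.+1 in uz_mono rung no_up no_dn.
  have Lu i : i < m -> L (u i) by move/rung=> /ltIP[].
  have Lz i : i < m -> L (z i) by move/rung=> /ltIP[].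
  pose e i j (c d : 'I_k'.+1) := flow r i j (el lab (anti r i) c) (el lab (anti r j) d).
  suff : m <= 2 * k'.+1 * k'.+1 by rewrite ltnn.
  apply: (@regular_ladder k'.+1 L (fun i j => sub r (anti r i) (anti r j)) e _ _ _ _ _ _ _ _ _
    m u z (fun i => lab (u i)) (fun i => lab (z i))).
  - exact: (level_refl rxx ranti rtr labP).
  - exact: (level_total rxx ranti rtr labP).
  - by move=> i j l Li Lj Ll; apply: (level_trans rxx ranti rtr labP).
  - by move=> i j c d Li Lj F; apply: (flow_le rxx ranti rtr labP F).
  - by move=> i j c Li Lj ij; apply: (flow_id rxx ranti rtr labP).
  - by move=> i j l c d f Li Lj Ll F G; apply: flow_tr F G.
  - move=> i j c d Li Lj /flow_match[f [fc fF f_inj]].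
    have [mi _ _] := lvA i Li; have [mj _ _] := lvA j Lj.
    have elA x : el lab (anti r i) x \in anti r i by apply: (el_in labP _ mi).
    have fA x : f (el lab (anti r i) x) \in anti r j by have [] := flow_mem (fF _ (elA x)).
    exists (fun x => lab (f (el lab (anti r i) x))); split.
    + move=> a b /(lab_inj labP mj (fA a) (fA b))/f_inj E'.
      by rewrite -(lab_el labP a mi) E' // (lab_el labP _ mi).
    + by rewrite fc (lab_el labP _ mj).
    + by move=> x; rewrite /e (el_lab labP mj (fA x)); apply: fF.
  - move=> i j l c d Li Lj Ll F ij jl old.
    have [y [Fij Fjl]] := flow_factor_up rxx ranti rtr labP Li Lj Ll F ij jl old.
    have [mj _ _] := lvA j Lj; have [_ yA] := flow_mem Fij.
    by exists (lab y); rewrite /e (el_lab labP mj yA).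
  - move=> i j l c d Li Lj Ll F ij jl old.
    have [y [Fij Fjl]] := flow_factor_dn rxx ranti rtr labP Li Lj Ll F ij jl old.
    have [mj _ _] := lvA j Lj; have [_ yA] := flow_mem Fij.
    by exists (lab y); rewrite /e (el_lab labP mj yA).
  - exact: Lu.
  - exact: Lz.
  - move=> i j ij jm; have im := ltn_trans ij jm; rewrite /e !elE; [|exact: Lu..].
    by have /andP[/ltIP[]] := uz_mono i j ij jm.
  - move=> i j ij jm; have im := ltn_trans ij jm; rewrite /e !elE; [|exact: Lz..].
    by have /andP[_ /ltIP[]] := uz_mono i j ij jm.
  - move=> i im; rewrite /e !elE; [|exact: Lz|exact: Lu].
    by have /ltIP[] := rung i im.
  - move=> i j ij jm; have im := ltn_trans ij jm; rewrite /e !elE; [|exact: Lz|exact: Lu].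
    move=> F; have /negP[] := no_up i j ij jm; apply/ltIP; split; [exact: Lu|exact: Lz| |by []].
    by have /andP[_] := no_dn i j im jm; rewrite eq_sym.
  - move=> i j im jm; rewrite /e !elE; [|exact: Lu|exact: Lz].
    move=> F; have /andP[/negP nlt neq] := no_dn i j im jm.
    by apply: nlt; apply/ltIP; split; [exact: Lz|exact: Lu| |].
(* [inord] is faithful on [Q], where colours do not exceed that of [n]. *)
pose colI (i : 'I_N) : 'I_(col r n).+1 := inord (col r i).
have colIE i : i \in Q -> val (colI i) = col r i.
  by rewrite inE => /andP[_ le_c]; rewrite /= inordK.
have QP i : i \in Q -> lev r i = k'.+1 by rewrite inE => /andP[/eqP].
have inQ i : lev r i = k'.+1 -> col r i <= col r n -> i < N ->
    exists2 j : 'I_N, j \in Q & val j = i.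
  by move=> li ci iN; exists (Ordinal iN); rewrite ?inE //= li eqxx.
have g : grundy colI lt Q setT.
  split=> [c _|i j iQ jQ E'|i iQ c _ lt_c].
  - have [eq_c|ne_c] := eqVneq (val c) (col r n).
      have [j jQ jn] := inQ n E (leqnn _) (ltnSn n).
      by exists j => //; apply: val_inj; rewrite colIE // jn.
    have [|i [lt_i li ci _]] := (colP r n).2 (val c).
      by rewrite ltn_neqAle ne_c -ltnS ltn_ord.
    have [|||j jQ ji] := inQ i.
    + by rewrite li.
    + by rewrite ci -ltnS ltn_ord.
    + by rewrite /N ltnW.
    by exists j => //; apply: val_inj; rewrite colIE // ji.
  - have eq_c : col r i = col r j by rewrite -!colIE // E'.
    have eq_l : lev r i = lev r j by rewrite !QP.
    have [// | ne_ij] := eqVneq i j.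
    rewrite /lt !QP // !eqxx /=.
    case: (ltngtP i j) => [ij|ji|/val_inj eq_ij].
    + exact: (colP r j).1.
    + by rewrite orbC; apply: (colP r i).1.
    + by rewrite eq_ij eqxx in ne_ij.
  - have lt_c' : c < col r i by rewrite -(colIE i iQ).
    have [a [lt_a la ca na]] := (colP r i).2 _ lt_c'.
    have [|||z zQ za] := inQ a.
    + by rewrite la QP.
    + by rewrite ca -ltnS ltn_ord.
    + exact: ltn_trans lt_a (ltn_ord i).
    exists z => //; split; first by apply: val_inj; rewrite colIE // za.
    rewrite /inc /lt za; move: na; rewrite negb_or => /andP[/negPf-> /negPf->].
    by rewrite !andbF !andbT; apply: contraTneq lt_a => ->; rewrite -za ltnn.
have := first_fit_bound R lt_irr lt_trans (ltn0Sn _) (ltn0Sn _) wQ noL g.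
by rewrite cardsT card_ord.
Qed.

End ColourBound.

(** * The on-line algorithm *)

Section Index.
Variables (d : Order.disp_t) (V : finPOrderType d) (s : presentation V).

Lemma prec_irr x : prec s x x = false.
Proof. by have /and3P[/forallP/(_ x)/negPf] := svalP s. Qed.

Lemma prec_trans y x z : prec s x y -> prec s y z -> prec s x z.
Proof.
have /and3P[_ /forallP/(_ x)/forallP/(_ y)/forallP/(_ z)/implyP tr _] := svalP s.
by move=> xy yz; apply: tr; apply/andP.
Qed.

Lemma prec_total x y : x != y -> prec s x y || prec s y x.
Proof.
by have /and3P[_ _ /forallP/(_ x)/forallP/(_ y)/implyP] := svalP s.
Qed.

Definition idx (x : V) : nat := #|[set y | prec s y x]|.

Lemma idx_mono x y : prec s x y -> idx x < idx y.
Proof.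
move=> xy; apply/proper_card/properP; split.
  by apply/subsetP=> z; rewrite !inE => /prec_trans; apply.
by exists x; rewrite inE // prec_irr.
Qed.

Lemma idx_inj : injective idx.
Proof.
move=> x y E; apply/eqP/negPn/negP=> /prec_total/orP[]/idx_mono; rewrite E ltnn //.
Qed.

Lemma idx_lt x : idx x < #|V|.
Proof.
rewrite -cardsT; apply/proper_card/properP; split; first exact: subsetT.
by exists x; rewrite inE // prec_irr.
Qed.

Lemma idx_onto i : i < #|V| -> exists x, idx x = i.
Proof.
move=> lt_i; pose f x : 'I_#|V| := Ordinal (idx_lt x).
have f_inj : injective f by move=> x y [] /idx_inj.
have [|g fg gf] := inj_card_bij f_inj; first by rewrite card_ord.
by exists (g (Ordinal lt_i)); have := congr1 val (gf (Ordinal lt_i)).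
Qed.

Lemma idxP i : (exists x, i = idx x) \/ #|V| <= i.
Proof. by case: (ltnP i #|V|) => [/idx_onto[x <-]|]; [left; exists x | right]. Qed.

(* The presented poset with its vertices named by their positions, continued
   by an infinite chain above it. *)
Definition orel : rel nat := fun i j =>
  [exists x, exists y, [&& idx x == i, idx y == j & (x <= y)%O]] || (#|V| <= j) && (i <= j).

Lemma orelE x y : orel (idx x) (idx y) = (x <= y)%O.
Proof.
rewrite /orel [_ <= idx y]leqNgt idx_lt orbF; apply/existsP/idP.
  by case=> x' /existsP[y' /and3P[/eqP/idx_inj-> /eqP/idx_inj->]].
by move=> xy; exists x; apply/existsP; exists y; rewrite !eqxx.
Qed.

Lemma orel_ge i j : #|V| <= j -> orel i j = (i <= j).
Proof.
move=> le_j; rewrite /orel le_j /= orb_idl // => /existsP[x /existsP[y /and3P[_ /eqP yj _]]].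
by move: (idx_lt y); rewrite yj ltnNge le_j.
Qed.

Lemma orel_lt i x : #|V| <= i -> orel i (idx x) = false.
Proof.
move=> le_i; rewrite /orel [_ <= idx x]leqNgt idx_lt orbF; apply/existsP=> -[y /existsP[z]].
by case/and3P=> /eqP yi; move: (idx_lt y); rewrite yi ltnNge le_i.
Qed.

Lemma orel_refl : reflexive orel.
Proof. by move=> i; have [[x ->]|le_i] := idxP i; rewrite ?orelE ?orel_ge. Qed.

Lemma orel_anti : antisymmetric orel.
Proof.
move=> i j; have [[x ->]|le_i] := idxP i; have [[y ->]|le_j] := idxP j.
- by rewrite !orelE => /le_anti->.
- by rewrite (orel_lt _ le_j) andbF.
- by rewrite (orel_lt _ le_i).
- by rewrite !orel_ge // => /andP[ij ji]; apply/eqP; rewrite eqn_leq ij.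
Qed.

Lemma orel_trans : transitive orel.
Proof.
move=> j i l; have [[x ->]|le_j] := idxP j; last first.
  have [[z ->]|le_l] := idxP l; first by rewrite (orel_lt _ le_j).
  by rewrite !orel_ge //; apply: leq_trans.
have [[y ->]|le_i] := idxP i; last by rewrite (orel_lt _ le_i).
have [[z ->]|le_l] := idxP l; first by rewrite !orelE; apply: le_trans.
by rewrite orelE !orel_ge // => _ _; apply: leq_trans (ltnW (idx_lt y)) le_l.
Qed.

(** An antichain that meets the added chain is a singleton, whence [0 < w]. *)
Lemma orel_width w : 0 < w -> width V <= w -> width_bound orel xpredT w.
Proof.
move=> w_gt0 leVw S uS _ aS.
have [/allP ltS|/allPn[i iS nlt_i]] := boolP (all (fun i => i < #|V|) S); last first.
  apply: leq_trans w_gt0.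
  have big j : j \in S -> j = i.
    move=> jS; have le_i : #|V| <= i by rewrite leqNgt.
    have [le_ji|lt_ij] := leqP j i; first by apply: aS; rewrite ?orel_ge.
    apply/esym/aS => //; rewrite orel_ge ?(ltnW lt_ij) //.
    exact: leq_trans le_i (ltnW lt_ij).
  rewrite (@uniq_leq_size _ S [:: i]) // => j /big->; exact: mem_head.
pose A := [set x | idx x \in S].
have leSA : size S <= #|A|.
  rewrite cardE -(size_map idx); apply: uniq_leq_size => // i iS.
  have [x xi] := idx_onto (ltS i iS).
  by apply/mapP; exists x; rewrite ?mem_enum ?inE xi.
apply: leq_trans leSA _.
apply: leq_trans leVw; apply: (leq_bigmax_cond A).
apply/forall_inP=> x xA; apply/forall_inP=> y yA; apply/implyP=> ne_xy.
rewrite !inE in xA yA; rewrite /Order.comparable negb_or.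
apply/andP; split; apply: contraNN ne_xy => le_xy; apply/eqP/idx_inj.
  by apply: aS; rewrite ?orelE.
by apply/esym/aS; rewrite ?orelE.
Qed.

Lemma preceq_idx x y : preceq s x y = (idx x <= idx y).
Proof.
apply/predU1P/idP=> [[->//|/idx_mono/ltnW//]|le_xy].
have [->|ne_xy] := eqVneq x y; first by left.
right; have /orP[//|/idx_mono] := prec_total ne_xy.
by rewrite ltnNge le_xy.
Qed.

Lemma card_initial v : #|{: {x : V | preceq s x v}}| = (idx v).+1.
Proof.
rewrite card_sig (_ : _.+1 = #|v |: [set y | prec s y v]|).
  by apply: eq_card => y; rewrite !inE.
by rewrite cardsU1 inE prec_irr.
Qed.

(** Positions can be counted inside the history, hence are invariant under isomorphism of
    histories. *)
Lemma idx_initial v (x : {x : V | preceq s x v}) :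
  idx (val x) = #|[set y : {x : V | preceq s x v} | prec s (val y) (val x)]|.
Proof.
rewrite -(card_imset _ val_inj); apply: eq_card => y; rewrite inE.
apply/idP/imsetP=> [yx|[y' + ->]]; last by rewrite inE.
have yv : preceq s y v.
  rewrite preceq_idx; apply: leq_trans (ltnW (idx_mono yx)) _.
  by rewrite -preceq_idx (valP x).
by exists (exist _ y yv); rewrite ?inE.
Qed.

End Index.

Lemma same_history_agree d (V : finPOrderType d) d' (W : finPOrderType d')
    (s : presentation V) (v : V) (t : presentation W) (w : W) :
  same_history s v t w -> idx s v = idx t w /\ agree (idx s v) (orel s) (orel t).
Proof.
rewrite /same_history /initial => -[f [f_bij f_le f_prec]].
have idx_f x : idx t (val (f x)) = idx s (val x).
  rewrite !idx_initial -(card_imset _ (bij_inj f_bij)); apply: eq_card => y.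
  have [g fg gf] := f_bij; rewrite inE; apply/idP/imsetP=> [yx|[z]].
    by exists (g y); rewrite ?gf // inE -f_prec gf.
  by rewrite inE => zx ->; rewrite f_prec.
split; first by have := bij_eq_card f_bij; rewrite !card_initial => -[].
have lift i : i <= idx s v -> exists x : {x : V | preceq s x v}, idx s (val x) = i.
  move=> le_i; have [x xi] := idx_onto s (leq_ltn_trans le_i (idx_lt s v)).
  have xv : preceq s x v by rewrite preceq_idx xi.
  by exists (exist _ x xv).
by move=> i j /lift[x <-] /lift[y <-]; rewrite orelE -!idx_f orelE f_le.
Qed.

(** Encoding the level along with the colour keeps the chains of different levels apart. *)
Definition reg_assign d (V : finPOrderType d) (s : presentation V) (v : V) : nat :=
  pickle (lev (orel s) (idx s v), col (orel s) (idx s v)).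

Lemma reg_assign_chain d (V : finPOrderType d) (s : presentation V) (x y : V) :
  reg_assign s x = reg_assign s y -> (x >=< y)%O.
Proof.
move=> /(pcan_inj pickleK)[lxy cxy].
have := col_chain (@orel_refl _ _ s) (@orel_trans _ _ s) lxy cxy.
by rewrite !orelE.
Qed.

Lemma reg_assign_online d (V : finPOrderType d) d' (W : finPOrderType d')
    (s : presentation V) (v : V) (t : presentation W) (w : W) :
  same_history s v t w -> reg_assign s v = reg_assign t w.
Proof.
case/same_history_agree=> vw ag.
by rewrite /reg_assign -vw (lev_online ag) (col_online ag).
Qed.

Definition reg_algorithm : algorithm := Algorithm reg_assign_chain reg_assign_online.

(** * The number of chains *)

From mathcomp Require Import classical_sets constructive_ereal ereal.

Local Open Scope ring_scope.

Lemma chi_online_bound d (V : finPOrderType d) (s : presentation V) (w B : nat) :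
    (0 < w)%N -> (width V <= w)%N ->
    (forall n, (lev (orel s) n <= w)%N -> (col (orel s) n < B)%N) ->
  (chi_online reg_algorithm s <= w * B)%N.
Proof.
move=> w_gt0 leVw ltB.
have lev_le n : (lev (orel s) n <= w)%N.
  apply: (levP _ n).2 => j le_j S uS _ aS; apply: leq_trans le_j.
  by apply: (orel_width w_gt0 leVw uS _ aS); apply/allP.
pose colours : seq nat := [seq pickle (k, c) | k <- iota 1 w, c <- iota 0 B].
have -> : (w * B = size colours)%N by rewrite size_allpairs !size_iota.
apply: uniq_leq_size; first exact: undup_uniq.
move=> c; rewrite mem_undup => /mapP[v _ ->]; apply: allpairs_f.
  by rewrite mem_iota lev_gt0 add1n ltnS lev_le.
by rewrite mem_iota /= add0n ltB.
Qed.

(** * The final estimate *)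

Section Final.
Variable R : realType.

Definition level_bound (w : nat) : R :=
  expR (13 / 2 * (ln w%:R / ln 2) * ln w%:R +
    (9 / 2 + (ln 5 + 2 * ln 3) / ln 2) * ln w%:R).

(** By [2 k^2 + 1 <= 3 k^2], the term [2 lg m] of the exponent is at most [4 lg k + 2 lg 3], which
    raises [5/2] to [13/2]. *)
Lemma ff_bound_le (k w : nat) : (0 < k)%N -> (k <= w)%N ->
  ff_bound R (2 * k * k).+1 k <= level_bound w.
Proof.
move=> k_gt0 le_kw; have w_gt0 : (0 < w)%N := leq_trans k_gt0 le_kw.
rewrite /ff_bound /level_bound ler_expR /ff_exponent.
have pos n : (0 < n)%N -> (n%:R : R) \is Num.pos by move=> n_gt0; rewrite posrE ltr0n.
have L_gt0 : 0 < ln 2 :> R by rewrite ln_gt0 // ltr1n.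
have l3_ge0 : 0 <= ln 3 :> R by rewrite ln_ge0 // ler1n.
have l5_ge0 : 0 <= ln 5 :> R by rewrite ln_ge0 // ler1n.
have y_ge0 : 0 <= ln k%:R :> R by rewrite ln_ge0 // ler1n.
have le_yz : ln k%:R <= ln w%:R :> R by rewrite ler_ln ?pos // ler_nat.
have mu_le : ln (2 * k * k).+1%:R <= ln 3 + 2 * ln k%:R :> R.
  have -> : ln 3 + 2 * ln k%:R = ln (3 * k * k)%:R :> R.
    by rewrite !natrM !lnM ?posrE ?mulr_gt0 ?ltr0n //; ring.
  rewrite ler_ln ?pos ?muln_gt0 ?k_gt0 // ler_nat.
  by have : (0 < k * k)%N; [rewrite muln_gt0 k_gt0 | lia].
move: (ln (2 * k * k).+1%:R) (ln k%:R) (ln w%:R) (ln 2) (ln 3) (ln 5)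
  L_gt0 l3_ge0 l5_ge0 y_ge0 le_yz mu_le => mu y z L l3 l5 L_gt0 l3_ge0 l5_ge0 y_ge0 le_yz mu_le.
have V_gt0 : 0 < L^-1 by rewrite invr_gt0.
have -> : 5 / (2 * L) * y ^+ 2 + (9 / 2 * L + l5 + 2 * mu) / L * y =
    5 / 2 * L^-1 * (y * y) + (9 / 2 + (l5 + 2 * mu) * L^-1) * y.
  by field; rewrite gt_eqF.
apply: (@le_trans _ _ (13 / 2 * (y * L^-1) * y + (9 / 2 + (l5 + 2 * l3) * L^-1) * y)).
  have : (l5 + 2 * mu) * L^-1 <= (l5 + 2 * (l3 + 2 * y)) * L^-1.
    by rewrite ler_pM2r //; lra.
  by move=> /(ler_wpM2r y_ge0); move: (L^-1) => u; lra.
have z_ge0 : 0 <= z by apply: le_trans le_yz.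
apply: lerD.
  rewrite -!mulrA; apply: ler_wpM2l; first by lra.
  by apply: ler_wpM2l; first lra; rewrite mulrCA [leRHS]mulrCA; apply: ler_wpM2l; [lra|nra].
apply: ler_wpM2l => //; apply: addr_ge0; first by lra.
by apply: mulr_ge0; [lra | apply: ltW].
Qed.

End Final.

Theorem theorem1p2 (R : realType) :
  exists C : R, forall w : nat, (0 < w)%N ->
    (online_val R w <= (w%:R `^ (13 / 2 * lg w%:R + C))%:E)%E.
Proof.
(* The last [1] pays for the factor [w], the number of levels. *)
exists (9 / 2 + (ln 5 + 2 * ln 3) / ln 2 + 1) => w w_gt0.
set bnd := _ `^ _.
have wR_gt0 : 0 < w%:R :> R by rewrite ltr0n.
have bndE : bnd = w%:R * level_bound R w.
  rewrite /bnd /powR gt_eqF // /level_bound /lg -[X in _ = X * _](@lnK R) ?posrE //.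
  by rewrite -expRD; congr expR; ring.
have lb_ge0 : 0 <= level_bound R w by apply: expR_ge0.
apply: (@le_trans _ _ (val_alg R reg_algorithm w)).
  by apply: ereal_inf_lbound; exists reg_algorithm.
apply: ub_ereal_sup => _ [d [V [wV ->]]]; rewrite lee_fin bndE.
pose B := Num.truncn (level_bound R w).
suff chi_le : (chi reg_algorithm V <= w * B)%N.
  apply: (@le_trans _ _ (w * B)%:R); first by rewrite ler_nat.
  by rewrite natrM ler_pM2l // truncn_le.
apply/bigmax_leqP => s _; apply: chi_online_bound => //; first by rewrite wV.
move=> n le_n; rewrite truncn_ge_nat //.
apply: le_trans (ff_bound_le R (lev_gt0 _ n) le_n).
exact: (col_bound R (@orel_refl _ _ s) (@orel_anti _ _ s) (@orel_trans _ _ s)).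
Qed.
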